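(* Let $f:U\to\mathbf{R}^3$ be a $C^\infty$-map defined on an open subset $U$ of $\mathbf{R}^2$ and let $p\in U$ be a cross cap singular point of $f$. Let $T_2$ be the reflection of $\mathbf{R}^3$ with respect to the normal plane of $f$ at $p$. Then the following three assertions are equivalent: (i) The image germ of $f$ at $p$ is invariant under $T_2$. (ii) There exist a connected open neighborhood $W\subset U$ of $p$ and an involutive orientation preserving $C^\infty$-diffeomorphism $\varphi:W\to W$ such that $f\circ\varphi=T_2\circ f$ on $W$. (iii) The characteristic functions $a,b$ of $f$ at $p$ satisfy $a(u,v)=a(-u,-v)$ and $b(v)=b(-v)$ for all $(u,v)$ sufficiently close to $(0,0)$.
   Context: A $C^\infty$-map $f:U\to\mathbf{R}^3$ has a cross cap singular point at $p\in U$ if its germ at $p$ is right-left equivalent (by local diffeomorphisms of source and target) to the germ at the origin of $(u,v)\mapsto(u,uv,v^2)$. Let $(u,v)$ be local coordinates centered at $p$ with $f_v(0,0)=\mathbf{0}$; then $f_u(0,0)\neq\mathbf{0}$. The tangent line at the cross cap is $\{f(p)+tf_u(0,0)\,;\,t\in\mathbf{R}\}$, and the normal plane is the plane passing through $f(p)$ perpendicular to the tangent line; they do not depend on the choice of such coordinates. Characteristic functions: it is known that there exist a positive (i.e. positively oriented) local coordinate system $(u,v)$ centered at $p$, an orientation preserving isometry $S$ of $\mathbf{R}^3$, and $C^\infty$-functions $a(u,v)$, $b(v)$ satisfying $b(0)=b'(0)=b''(0)=0$, $a(0,0)=a_u(0,0)=a_v(0,0)=0$, $a_{vv}(0,0)>0$,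 such that near $p$ one has $S\circ f(u,v)=(u,\,uv+b(v),\,a(u,v))$. In any such representation $a$ and $b$ are called the (first and second) characteristic functions of $f$ at $p$; they are considered as germs at the origin. The image germ of $f$ at $p$ is invariant under an isometry $T$ if for every neighborhood $U'\subset U$ of $p$ there is a neighborhood $V\subset U'$ of $p$ such that $T(f(V))\subset f(U')$.
   Formalization: Assertion (ii) additionally requires φ(p)=p; without it (ii)⇒(i) fails, since on a large W the involution φ may exchange p with another point having the same image. The condition is automatic when W is small. *)

(* Defs.v *)
From HB Require Import structures.
From mathcomp Require Import all_boot all_order all_algebra.
From mathcomp Require Import all_classical all_reals all_analysis.

Set Implicit Arguments.
Unset Strict Implicit.
Unset Printing Implicit Defensive.

Import Order.TTheory GRing.Theory Num.Theory.
Import numFieldNormedType.Exports.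

Local Open Scope classical_set_scope.
Local Open Scope ring_scope.

(* Points of R^2 and R^3 are row vectors; u and v are the entries of index
   0 and 1 of a point of the plane. *)

Section smooth.
Context {R : realType} {V W : normedModType R}.

(* For V of finite dimension and A open, this is the usual class C^n: all
   iterated directional derivatives up to order n exist and are continuous
   on A. *)
Fixpoint class_C (n : nat) (A : set V) (f : V -> W) : Prop :=
  match n with
  | 0%N => forall x, A x -> {for x, continuous f}
  | m.+1 => [/\ forall x, A x -> {for x, continuous f},
               forall x w, A x -> derivable f x w &
               forall w, class_C m A ('D_w f)]
  end.

Definition smooth (A : set V) (f : V -> W) := forall n, class_C n A f.

Definition smooth_near (x : V) (f : V -> W) :=
  exists A : set V, [/\ open A, A x & smooth A f].

End smooth.

Definition diffeomorphism {R : realType} {V W : normedModType R}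
    (A : set V) (B : set W) (h : V -> W) :=
  [/\ open A, open B, smooth A h, set_bij A B h &
      exists k : W -> V, smooth B k /\ (forall x, A x -> k (h x) = x)].

Definition orientation_preserving_on {R : realType} {n : nat}
    (A : set 'rV[R]_n.+1) (h : 'rV[R]_n.+1 -> 'rV[R]_n.+1) :=
  forall x, A x -> 0 < \det ('J h x).

Section euclidean.
Context {R : realType}.

Definition row3 (x y z : R) : 'rV[R]_3 := \row_(j < 3) [:: x; y; z]`_j.

Definition dot (x y : 'rV[R]_3) : R := \sum_(i < 3) x 0 i * y 0 i.

(* The library norm of 'rV[R]_3 is the sup norm. *)
Definition edist (x y : 'rV[R]_3) : R := Num.sqrt (dot (x - y) (x - y)).

Definition orientation_preserving_isometry (S : 'rV[R]_3 -> 'rV[R]_3) :=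
  (forall x y, edist (S x) (S y) = edist x y) /\
  orientation_preserving_on setT S.

(* Reflection with respect to the plane through c perpendicular to t != 0. *)
Definition reflection (c t x : 'rV[R]_3) : 'rV[R]_3 :=
  x - (2 * (dot (x - c) t / dot t t)) *: t.

End euclidean.

Section crosscap.
Context {R : realType}.
Implicit Types (U N : set 'rV[R]_2) (f : 'rV[R]_2 -> 'rV[R]_3) (p : 'rV[R]_2).

Definition e_u : 'rV[R]_2 := delta_mx 0 0.
Definition e_v : 'rV[R]_2 := delta_mx 0 1.

Definition standard_cross_cap (q : 'rV[R]_2) : 'rV[R]_3 :=
  row3 (q 0 0) (q 0 0 * q 0 1) (q 0 1 ^+ 2).

Definition cross_cap U f p :=
  exists (N N0 : set 'rV[R]_2) (M M0 : set 'rV[R]_3)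
         (phi : 'rV[R]_2 -> 'rV[R]_2) (Phi : 'rV[R]_3 -> 'rV[R]_3),
    [/\ N `<=` U, N p, M (f p) & forall q, N q -> M (f q)] /\
    [/\ diffeomorphism N N0 phi, phi p = 0,
        diffeomorphism M M0 Phi, Phi (f p) = 0 &
        forall q, N q -> Phi (f q) = standard_cross_cap (phi q)].

(* A coordinate system centered at p is given by its inverse psi, which sends
   (u, v) in the open set N to the point of U with these coordinates. *)
Definition local_coordinates U p N (psi : 'rV[R]_2 -> 'rV[R]_2) :=
  [/\ N 0, psi 0 = p, psi @` N `<=` U & diffeomorphism N (psi @` N) psi].

(* t = f_u(0,0) for some coordinates centered at p such that f_v(0,0) = 0;
   at a cross cap, the normal plane at p is the plane through f p
   perpendicular to t. *)
Definition tangent_vector U f p (t : 'rV[R]_3) :=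
  exists N psi, [/\ local_coordinates U p N psi,
    'D_e_v (f \o psi) 0 = 0 & 'D_e_u (f \o psi) 0 = t].

Definition characteristic_functions U f p (a : 'rV[R]_2 -> R) (b : R -> R) :=
  [/\ smooth_near 0 b, b 0 = 0, (b^`())%classic 0 = 0 & (b^`(2))%classic 0 = 0] /\
  [/\ smooth_near 0 a, a 0 = 0, 'D_e_u a 0 = 0, 'D_e_v a 0 = 0 &
      0 < 'D_e_v ('D_e_v a) 0] /\
  exists N psi S,
    [/\ local_coordinates U p N psi, orientation_preserving_on N psi,
        orientation_preserving_isometry S &
        forall q, N q -> S (f (psi q)) =
          row3 (q 0 0) (q 0 0 * q 0 1 + b (q 0 1)) (a q)].

Definition image_germ_invariant U f p (T : 'rV[R]_3 -> 'rV[R]_3) :=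
  forall U', nbhs p U' -> U' `<=` U ->
  exists V, [/\ nbhs p V, V `<=` U' & T @` (f @` V) `<=` f @` U'].

(* phi is required to fix p: otherwise phi could exchange p with another point
   having the same image under f, and would say nothing about the germ at p. *)
Definition has_symmetry U f p (T : 'rV[R]_3 -> 'rV[R]_3) :=
  exists (W : set 'rV[R]_2) (phi : 'rV[R]_2 -> 'rV[R]_2),
    [/\ open W, connected W, W p & W `<=` U] /\
    [/\ diffeomorphism W W phi, orientation_preserving_on W phi,
        phi p = p, (forall q, W q -> phi (phi q) = q) &
        forall q, W q -> f (phi q) = T (f q)].

Definition symmetric_characteristic_functions
    (a : 'rV[R]_2 -> R) (b : R -> R) :=
  (\forall q \near (0 : 'rV[R]_2), a q = a (- q)) /\
  (\forall v \near (0 : R), b v = b (- v)).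

End crosscap.

(* Main.v *)
Require Import Defs.
From HB Require Import structures.
From mathcomp Require Import all_boot all_order all_algebra.
From mathcomp Require Import all_classical all_reals all_analysis.
From mathcomp Require Import perm ring lra.
Import Order.TTheory GRing.Theory Num.Theory.
Import numFieldNormedType.Exports.
Local Open Scope classical_set_scope.
Local Open Scope ring_scope.

(** Suppose that the image germ is invariant under T2; the work is to lift T2 to the
    source. In coordinates in which f is the standard cross cap
    X (u, v) = (u, u v, v^2), the reflection becomes a local involution G of R^3 that
    maps the image of X into the zero set of the polynomial y^2 - x^2 z.
    The half-line x = y = 0 < z is the curve of double points, where two sheets cross
    transversally; comparison of the differentials shows that G maps it into the plane x = 0
    (double_curve_invariant). So the first two components of G \o X vanish on the axis
    u = 0, and Hadamard's lemma (hadamard) factors them as u alpha and u beta with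
    smooth alpha and beta. The lift is eta = (u alpha, beta / alpha), since a point
    (x, y, z) of the image with x <> 0 comes from (x, y / x) only (lift_involution).
    The reflection reverses the tangent line and is trivial modulo it, which gives
    alpha = -1 and beta_v = 1 at the origin: hence eta preserves the orientation. An
    involution of a neighborhood of the origin in a chart is made into a symmetry on
    a connected invariant open set in symmetry_of_chart.

    Conversely, a symmetry makes the image germ invariant because it fixes p.

    In the normal form (u, u v + b(v), a(u, v)) the tangent line is the first axis
    (characteristic_reflection). If a and b are even, q |-> - q is the symmetry. For
    the converse, the symmetry has the form (u, v) |-> (-u, V(u, v)) with
    - u V + b(V) = u v + b(v). Since b vanishes to second order at 0, an argument of
    intermediate values forces V = - v and b(-v) = b(v) (symmetry_rigidity), and the
    evenness of a follows.

    The calculus of smooth maps between spaces of row vectors that this requires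
    (differentiability from continuous partial derivatives, composition,
    differentiation under an integral) is developed from the directional derivatives
    that define smoothness. *)

Set Implicit Arguments.
Unset Strict Implicit.
Unset Printing Implicit Defensive.

(** * Closure properties of the class C^n *)

Section class_C_closure.
Context {R : realType} {V W : normedModType R}.
Implicit Types (A B : set V) (n : nat).

Lemma near_of_open A x (P : V -> Prop) :
  open A -> A x -> (forall y, A y -> P y) -> \forall y \near x, P y.
Proof. by move=> oA Ax AP; apply: filterS AP _; exact: open_nbhs_nbhs. Qed.

Lemma continuous_distP (f : V -> W) x : {for x, continuous f} <->
  forall e : R, 0 < e -> \forall y \near x, `|f x - f y| <= e.
Proof. exact: cvgrPdist_le. Qed.

Lemma class_C_ext n A (f g : V -> W) :
  open A -> (forall x, A x -> f x = g x) -> class_C n A f -> class_C n A g.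
Proof.
have cfg (h k : V -> W) x : open A -> (forall x, A x -> h x = k x) -> A x ->
    {for x, continuous h} -> {for x, continuous k}.
  move=> oA hk Ax; rewrite /prop_for /continuous_at -(hk _ Ax).
  by apply: cvg_trans; apply: near_eq_cvg; exact: near_of_open hk.
elim: n f g => [|n IH] f g oA fg /=; first by move=> cf x Ax; apply: (cfg f) => //; exact: cf.
move=> [cf df Cf]; split.
- by move=> x Ax; apply: (cfg f) => //; exact: cf.
- move=> x w Ax; apply: near_eq_derivable (df _ w Ax).
  exact: near_of_open fg.
- move=> w; apply: IH (Cf w) => // x Ax; apply: near_eq_derive.
  exact: near_of_open fg.
Qed.

Lemma class_C_sub n A B (f : V -> W) : B `<=` A -> class_C n A f -> class_C n B f.
Proof.
move=> BA; elim: n f => [|n IH] f /=; first by move=> cf x /BA; exact: cf.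
by move=> [cf df Cf]; split=> [x /BA|x w /BA|w]; [exact: cf|exact: df|exact: IH].
Qed.

Lemma class_CS n A (f : V -> W) : class_C n.+1 A f -> class_C n A f.
Proof.
elim: n f => [|n IH] f; first by case.
by move=> [cf df Cf]; split=> // w; apply: IH; exact: Cf.
Qed.

Lemma class_C_le m n A (f : V -> W) : (m <= n)%N -> class_C n A f -> class_C m A f.
Proof.
by move=> /subnK <-; elim: (n - m)%N => // k IH; rewrite addSn => /class_CS.
Qed.

Lemma class_C_cst n A (c : W) : class_C n A (cst c).
Proof.
elim: n c => [|n IH] c /=; first by move=> x _; exact: cvg_cst.
split=> [x _|x w _|w]; [exact: cvg_cst|exact: derivable_cst|].
suff -> : 'D_w (cst c : V -> W) = cst 0 by exact: IH.
by apply/funext => x; rewrite derive_cst.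
Qed.

Lemma class_CD n A (f g : V -> W) : open A ->
  class_C n A f -> class_C n A g -> class_C n A (fun x => f x + g x).
Proof.
move=> oA; elim: n f g => [|n IH] f g /=.
  by move=> cf cg x Ax; apply: continuousD; [exact: cf|exact: cg].
move=> [cf df Cf] [cg dg Cg]; split.
- by move=> x Ax; apply: continuousD; [exact: cf|exact: cg].
- by move=> x w Ax; apply: derivableD; [exact: df|exact: dg].
- move=> w; apply: class_C_ext (IH _ _ (Cf w) (Cg w)) => // x Ax.
  by rewrite -deriveD; [|exact: df|exact: dg].
Qed.

Lemma class_C_sum n A (I : Type) (r : seq I) (F : I -> V -> W) : open A ->
  (forall i, class_C n A (F i)) -> class_C n A (fun x => \sum_(i <- r) F i x).
Proof.
move=> oA CF; elim: r => [|i r IH].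
  by apply: class_C_ext (class_C_cst n A 0) => // x _; rewrite big_nil.
by apply: class_C_ext (class_CD oA (CF i) IH) => // x _; rewrite big_cons.
Qed.

Lemma smooth_sub A B (f : V -> W) : B `<=` A -> smooth A f -> smooth B f.
Proof. by move=> BA Cf n; exact: class_C_sub BA (Cf n). Qed.

Lemma smooth_ext A (f g : V -> W) :
  open A -> (forall x, A x -> f x = g x) -> smooth A f -> smooth A g.
Proof. by move=> oA fg Cf n; exact: class_C_ext fg (Cf n). Qed.

Lemma smooth_continuous A (f : V -> W) x :
  smooth A f -> A x -> {for x, continuous f}.
Proof. by move=> /(_ 0%N); exact. Qed.

Lemma smooth_derive A (f : V -> W) w : smooth A f -> smooth A ('D_w f).
Proof. by move=> Cf n; have [_ _] := Cf n.+1; exact. Qed.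

Lemma smooth_derivable A (f : V -> W) x w : smooth A f -> A x -> derivable f x w.
Proof. by move=> /(_ 1%N)[_ df _] Ax; exact: df. Qed.

End class_C_closure.

Section class_C_scalar.
Context {R : realType} {V : normedModType R}.
Implicit Types (A : set V) (n : nat) (f g : V -> R).

Lemma class_CM n A f g : open A ->
  class_C n A f -> class_C n A g -> class_C n A (fun x => f x * g x).
Proof.
move=> oA; elim: n f g => [|n IH] f g.
  by move=> cf cg x Ax; apply: continuousM; [exact: cf|exact: cg].
move=> Cf Cg; have [cf df Df] := Cf; have [cg dg Dg] := Cg; split.
- by move=> x Ax; apply: continuousM; [exact: cf|exact: cg].
- by move=> x w Ax; apply: derivableM; [exact: df|exact: dg].
- move=> w; apply: class_C_ext
    (class_CD oA (IH _ _ (class_CS Cf) (Dg w)) (IH _ _ (class_CS Cg) (Df w))) => // x Ax.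
  by rewrite (deriveM (df _ w Ax) (dg _ w Ax)).
Qed.

(** The derivative of 1/f is - (1/f) (1/f) f', a product whose factors are of
    class C^n when f is of class C^(n+1), by the induction hypothesis. *)
Lemma class_CV n A f : open A -> (forall x, A x -> f x != 0) ->
  class_C n A f -> class_C n A (fun x => (f x)^-1).
Proof.
move=> oA f0; elim: n => [|n IH].
  by move=> cf x Ax; apply: continuousV; [exact: f0|exact: cf].
move=> Cf; have [cf df Df] := Cf; split.
- by move=> x Ax; apply: continuousV; [exact: f0|exact: cf].
- by move=> x w Ax; apply: derivableV; [exact: f0|exact: df].
- have If := IH (class_CS Cf).
  move=> w; have Cg : class_C n A (fun x => - 1 * (f x)^-1 * (f x)^-1 * 'D_w f x).
    apply: class_CM (Df w) => //; apply: class_CM (If) => //.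
    by apply: class_CM (If) => //; exact: class_C_cst.
  apply: class_C_ext Cg => // x Ax.
  rewrite (deriveV (f0 _ Ax) (df _ w Ax)) /GRing.scale /= -exprVn expr2.
  by rewrite !mulN1r !mulNr.
Qed.

Lemma smoothM A f g : open A -> smooth A f -> smooth A g ->
  smooth A (fun x => f x * g x).
Proof. by move=> oA Cf Cg n; apply: class_CM (Cf n) (Cg n). Qed.

Lemma smoothV A f : open A -> (forall x, A x -> f x != 0) -> smooth A f ->
  smooth A (fun x => (f x)^-1).
Proof. by move=> oA f0 Cf n; apply: class_CV (Cf n). Qed.

End class_C_scalar.
(** * Differentiability and the chain rule for row vectors *)

Section lines.
Context {R : realType} {V : normedModType R}.

Lemma is_derive_line (W : normedModType R) (f : V -> W) x w (s : R) :
  derivable f (s *: w + x) w ->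
  is_derive s 1 (fun h : R => f (h *: w + x)) ('D_w f (s *: w + x)).
Proof.
have E : (fun h : R => h^-1 *: (f ((h *: 1 + s) *: w + x) - f (s *: w + x))) =
    (fun h : R => h^-1 *: (f (h *: w + (s *: w + x)) - f (s *: w + x))).
  by apply/funext => h; rewrite scalerDl addrA [h *: 1]mulr1.
by move=> df; split; rewrite /derivable /derive /= E.
Qed.

Lemma derive_on_line (W : normedModType R) (f g : V -> W) x w :
  (\forall s \near (0 : R), f (s *: w + x) = g (s *: w + x)) -> 'D_w f x = 'D_w g x.
Proof.
have E (h : V -> W) : 'D_w h x = 'D_1 (fun s : R => h (s *: w + x)) 0.
  rewrite /derive; set g1 := (fun s => s^-1 *: _); set g2 := (fun s => s^-1 *: _).
  suff -> : g1 = g2 by []; apply/funext => s; rewrite /g1 /g2 /=.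
  by rewrite addr0 scale0r add0r [s *: 1]mulr1.
by move=> fg; rewrite !E; apply: near_eq_derive.
Qed.

Lemma MVT_line (f : V -> R) x w (t : R) :
  (forall s : R, `|s| <= `|t| -> derivable f (s *: w + x) w) ->
  exists2 s : R, `|s| <= `|t| & f (t *: w + x) - f x = t * 'D_w f (s *: w + x).
Proof.
move=> df; pose g (s : R) := f (s *: w + x).
have dg (s : R) : `|s| <= `|t| -> is_derive s 1 g ('D_w f (s *: w + x)).
  by move=> st; apply: is_derive_line; exact: df.
have cg (i : interval R) : (forall s, s \in i -> `|s| <= `|t|) ->
    {within [set` i], continuous g}.
  by move=> it; apply: derivable_within_continuous => s /it /dg[].
have g0 : f x = g 0 by rewrite /g scale0r add0r.
rewrite -/(g t) g0.
have [t0|t0] := leP 0 t.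
- have it s : s \in `[0, t] -> `|s| <= `|t|.
    by rewrite in_itv /= => /andP[s0 st]; rewrite !ger0_norm.
  have [||c /it ct E] := @MVT_segment _ g (fun s => 'D_w f (s *: w + x)) 0 t t0.
  + by move=> s /subset_itv_oo_cc /it /dg.
  + exact: cg.
  + by exists c => //; rewrite E subr0 mulrC.
- have it s : s \in `[t, 0] -> `|s| <= `|t|.
    rewrite in_itv /= => /andP[s0 st].
    by rewrite (ltr0_norm t0) ler0_norm // lerN2.
  have [||c /it ct E] := @MVT_segment _ g (fun s => 'D_w f (s *: w + x)) t 0 (ltW t0).
  + by move=> s /subset_itv_oo_cc /it /dg.
  + exact: cg.
  + by exists c => //; rewrite -opprB E sub0r mulrN opprK mulrC.
Qed.

Lemma differentiable_of_estimate (W : normedModType R) (f : V -> W) x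
    (L : {linear V -> W}) : continuous L ->
  (forall e : R, 0 < e -> \forall h \near (0 : V),
     `|f (h + x) - f x - L h| <= e * `|h|) ->
  differentiable f x.
Proof.
move=> cL est.
have E : f \o shift x = cst (f x) + L +o_ 0 id.
  apply/eqaddoP => e e0; near=> h.
  rewrite /= opprD addrA; near: h; exact: est.
by apply/diff_locallyP; rewrite (diff_unique cL E).
Unshelve. all: by end_near. Qed.

End lines.

Section row_vectors.
Context {R : realType}.

Lemma row_norm_le n (x : 'rV[R]_n) (c : R) :
  0 <= c -> (forall i, `|x 0 i| <= c) -> `|x| <= c.
Proof.
move=> c0 xc; rewrite [leLHS]/Num.norm /= mx_normrE.
by apply: bigmax_le => // -[i j] _; rewrite ord1.
Qed.

Lemma row_coord_le n (x : 'rV[R]_n) i : `|x 0 i| <= `|x|.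
Proof.
rewrite [leRHS]/Num.norm /= mx_normrE.
exact: (le_bigmax _ (fun ij : 'I_1 * 'I_n => `|x ij.1 ij.2|) (0, i)).
Qed.

Lemma row_sum_basis n (x : 'rV[R]_n) : x = \sum_i x 0 i *: delta_mx 0 i.
Proof. exact: row_sum_delta. Qed.

Lemma is_derive_coord n i (x w : 'rV[R]_n) :
  is_derive x w (fun x : 'rV[R]_n => x 0 i) (w 0 i).
Proof.
split; first exact/diff_derivable/differentiable_coord.
have /derive_mx /(congr1 (fun M : 'rV[R]_n => M 0 i)) := @derivable_id _ _ x w.
by rewrite derive_id mxE.
Qed.

Lemma smooth_coord n (A : set 'rV[R]_n) i :
  smooth A (fun x : 'rV[R]_n => x 0 i).
Proof.
case=> [|k]; first by move=> x _; exact: coord_continuous.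
split=> [x _|x w _|w]; [exact: coord_continuous|by have [] := is_derive_coord i x w|].
suff -> : 'D_w (fun x : 'rV[R]_n => x 0 i) = cst (w 0 i) by exact: class_C_cst.
by apply/funext => x; have [] := is_derive_coord i x w.
Qed.

Lemma linear_form_continuous n (c : 'I_n -> R) :
  continuous (fun h : 'rV[R]_n => \sum_i h 0 i * c i).
Proof.
have C0 : class_C 0 setT (fun h : 'rV[R]_n => \sum_i h 0 i * c i).
  apply: class_C_sum => [|i]; first exact: openT.
  apply: class_CM; [exact: openT|exact: smooth_coord|exact: class_C_cst].
by move=> x; exact: C0.
Qed.

(** The increment of f is split along the coordinate axes, and the mean value
    theorem is applied to each piece. *)
Lemma class_C1_differentiable_scalar n (A : set 'rV[R]_n) (f : 'rV[R]_n -> R) x :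
  open A -> class_C 1 A f -> A x -> differentiable f x.
Proof.
move=> oA [_ df Cf] Ax.
pose c i := 'D_(delta_mx 0 i) f x.
have Llin : linear (fun h : 'rV[R]_n => \sum_i h 0 i * c i : R).
  move=> a u v; rewrite /GRing.scale /= mulr_sumr -big_split /=.
  by apply: eq_bigr => i _; rewrite !mxE mulrDl mulrA.
pose LM := GRing.isLinear.Build _ _ _ _ _ Llin.
pose L : {linear 'rV[R]_n -> R} := HB.pack (fun h : 'rV[R]_n => \sum_i h 0 i * c i : R) LM.
apply: (@differentiable_of_estimate _ _ _ f x L) => [|e e0].
  exact: linear_form_continuous.
have n0 : 0 < n%:R + 1 :> R by rewrite ltr_wpDl.
have en0 : 0 < e / (n%:R + 1) by rewrite divr_gt0.
have : \forall y \near x, A y /\ forall i, `|'D_(delta_mx 0 i) f y - c i| <= e / (n%:R + 1).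
  near=> y; split; first by near: y; exact: open_nbhs_nbhs.
  near: y; apply: filter_forall => i.
  have /cvgrPdist_le/(_ _ en0) : {for x, continuous ('D_(delta_mx 0 i) f)}.
    exact: (Cf (delta_mx 0 i)).
  by apply: filterS => y; rewrite distrC.
move=> /nbhs_ballP[r /= r0 Hr].
have : \forall h \near (0 : 'rV[R]_n), `|h| < r.
  by apply/nbhs_norm0P; exists r.
apply: filterS => h hr.
have inball (y : 'rV[R]_n) : `|y| <= `|h| -> ball x r (y + x).
  move=> yh; rewrite -ball_normE /ball_ /= opprD addrCA subrr addr0 normrN.
  exact: le_lt_trans hr.
pose P (j : nat) : 'rV[R]_n := \row_i (if (i < j)%N then h 0 i else 0).
have P0 : P 0%N = 0 by apply/rowP => i; rewrite !mxE ltn0.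
have Pn : P n = h by apply/rowP => i; rewrite !mxE ltn_ord.
have PS (j : 'I_n) : P j.+1 = h 0 j *: delta_mx 0 j + P j.
  apply/rowP => i; rewrite !mxE ltnS leq_eqVlt /=.
  have [/eqP ij|ij] := boolP (i == j).
    by rewrite ij eqxx ltnn mulr1 addr0.
  by rewrite (inj_eq val_inj) (negbTE ij) /= mulr0 add0r.
have step (j : 'I_n) :
    `|f (P j.+1 + x) - f (P j + x) - h 0 j * c j| <= e / (n%:R + 1) * `|h|.
  have pt (s : R) : `|s| <= `|h 0 j| -> ball x r (s *: delta_mx 0 j + (P j + x)).
    move=> sh; rewrite addrA; apply: inball; apply: row_norm_le => // i.
    rewrite !mxE /=; have [/eqP ij|ij] := boolP (i == j).
      by rewrite ij ltnn mulr1 addr0 (le_trans sh) // row_coord_le.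
    rewrite mulr0 add0r; case: ifP => _; first exact: row_coord_le.
    by rewrite normr0.
  rewrite PS -(addrA _ (P j) x).
  have [|s sh ->] := @MVT_line _ _ f (P j + x) (delta_mx 0 j) (h 0 j).
    by move=> s /pt /Hr[Ay _]; exact: df.
  rewrite -mulrBr normrM mulrC.
  have [_ /(_ j) dj] := Hr _ (pt _ sh).
  by apply: ler_pM => //; exact: row_coord_le.
have -> : f (h + x) - f x - L h =
    \sum_(j < n) (f (P j.+1 + x) - f (P j + x) - h 0 j * c j).
  rewrite big_split /= sumrN; congr (_ - _).
  rewrite -(big_mkord xpredT (fun j => f (P j.+1 + x) - f (P j + x))).
  by rewrite telescope_sumr // P0 add0r Pn.
apply: le_trans (ler_norm_sum _ _ _) _.
apply: le_trans (ler_sum _ (fun j _ => step j)) _.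
rewrite sumr_const card_ord -[leLHS]mulr_natr [leLHS]mulrAC; apply: ler_wpM2r => //.
rewrite mulrAC ler_pdivrMr //; apply: ler_wpM2l; first exact: ltW.
lra.
Unshelve. all: by end_near. Qed.

End row_vectors.
Section rows.
Context {R : realType}.

Lemma continuous_rowP (V : normedModType R) m (g : V -> 'rV[R]_m) x :
  {for x, continuous g} <-> forall i, {for x, continuous (fun y => g y 0 i)}.
Proof.
split=> [cg i|cg].
  by apply: (@continuous_comp _ _ _ g (fun M : 'rV[R]_m => M 0 i)) => //;
     exact: coord_continuous.
apply/cvgrPdist_le => e e0.
have : \forall y \near x, forall i, `|g x 0 i - g y 0 i| <= e.
  near=> y; near: y; apply: filter_forall => i.
  by have /cvgrPdist_le/(_ _ e0) := cg i.
apply: filterS => y gxy; apply: row_norm_le; first exact: ltW.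
by move=> i; rewrite !mxE.
Unshelve. all: by end_near. Qed.

Lemma derivable_rowP (V : normedModType R) m (g : V -> 'rV[R]_m) x w :
  derivable g x w <-> forall i, derivable (fun y => g y 0 i) x w.
Proof.
rewrite derivable_mxP; split=> [dg i|dg i j]; first exact: dg.
by rewrite ord1; exact: dg.
Qed.

Lemma derive_row (V : normedModType R) m (g : V -> 'rV[R]_m) x w i :
  derivable g x w -> 'D_w g x 0 i = 'D_w (fun y => g y 0 i) x.
Proof. by move=> dg; rewrite derive_mx // mxE. Qed.

Lemma class_C_rowP (V : normedModType R) m n (A : set V) (g : V -> 'rV[R]_m) :
  open A ->
  class_C n A g <-> forall i, class_C n A (fun y => g y 0 i).
Proof.
move=> oA; elim: n g => [|n IH] g /=.
  split=> [cg i x Ax|cg x Ax]; first by have /continuous_rowP := cg x Ax; exact.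
  by apply/continuous_rowP => i; exact: cg.
split=> [[cg dg Cg] i|Cg].
  split=> [x Ax|x w Ax|w].
  - by have /continuous_rowP := cg x Ax; exact.
  - by have /derivable_rowP := dg x w Ax; exact.
  - apply: class_C_ext ((IH _).1 (Cg w) i) => // x Ax.
    by rewrite derive_row //; exact: dg.
have dg x w : A x -> derivable g x w.
  by move=> Ax; apply/derivable_rowP => i; have [_ + _] := Cg i; exact.
split=> // [x Ax|w].
  by apply/continuous_rowP => i; have [+ _ _] := Cg i; exact.
apply/IH => i; have [_ _ /(_ w)] := Cg i.
by apply: class_C_ext => // x Ax; rewrite derive_row //; exact: dg.
Qed.

Lemma smooth_rowP (V : normedModType R) m (A : set V) (g : V -> 'rV[R]_m) :
  open A -> smooth A g <-> forall i, smooth A (fun y => g y 0 i).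
Proof.
move=> oA; split=> [Cg i n|Cg n]; first by have /class_C_rowP := Cg n; exact.
by apply/class_C_rowP => // i; exact: Cg.
Qed.

Lemma class_C1_differentiable k m (A : set 'rV[R]_k) (g : 'rV[R]_k -> 'rV[R]_m) x :
  open A -> class_C 1 A g -> A x -> differentiable g x.
Proof.
move=> oA /(class_C_rowP _ _ oA) Cg Ax.
have -> : g = \sum_(i < m) (fun y => g y 0 i *: delta_mx 0 i).
  by apply/funext => y; rewrite fct_sumE -row_sum_delta.
apply: differentiable_sum => i; apply: differentiableZl.
exact: class_C1_differentiable_scalar (Cg i) Ax.
Qed.

Lemma smooth_differentiable k m (A : set 'rV[R]_k) (g : 'rV[R]_k -> 'rV[R]_m) x :
  open A -> smooth A g -> A x -> differentiable g x.
Proof. by move=> oA /(_ 1%N); exact: class_C1_differentiable. Qed.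

Lemma smooth_differentiable_scalar k (A : set 'rV[R]_k) (g : 'rV[R]_k -> R) x :
  open A -> smooth A g -> A x -> differentiable g x.
Proof. by move=> oA /(_ 1%N); exact: class_C1_differentiable_scalar. Qed.

Lemma derive_basis (W : normedModType R) k (g : 'rV[R]_k -> W) x w :
  differentiable g x -> 'D_w g x = \sum_i w 0 i *: 'D_(delta_mx 0 i) g x.
Proof.
move=> dg; rewrite deriveE // [X in 'd g x X]row_sum_basis linear_sum.
by apply: eq_bigr => i _; rewrite linearZ /= deriveE.
Qed.

Lemma derive_comp (V : normedModType R) (W W' : normedModType R)
    (g : V -> W) (f : W -> W') x w :
  differentiable g x -> differentiable f (g x) ->
  'D_w (f \o g) x = 'D_('D_w g x) f (g x).
Proof.
move=> dg df; rewrite (deriveE w (differentiable_comp dg df)) diff_comp //=.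
by rewrite !deriveE.
Qed.

(** The derivative of f \o g along w is the sum of the products of the components of
    'D_w g by the partial derivatives of f composed with g, so the order of
    smoothness goes up by induction. *)
Lemma class_C_comp_scalar k m n (A : set 'rV[R]_k) (B : set 'rV[R]_m)
    (g : 'rV[R]_k -> 'rV[R]_m) (f : 'rV[R]_m -> R) :
  open A -> open B -> (forall x, A x -> B (g x)) ->
  class_C n A g -> class_C n B f -> class_C n A (f \o g).
Proof.
move=> oA oB AB; elim: n g f AB => [|n IH] g f AB.
  by move=> cg cf x Ax; apply: continuous_comp; [exact: cg|apply: cf; exact: AB].
move=> Cg Cf; have [cg _ Dg] := Cg; have [cf _ Df] := Cf.
have dg x : A x -> differentiable g x.
  by move=> Ax; apply: (class_C1_differentiable oA _ Ax); exact: class_C_le Cg.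
have df y : B y -> differentiable f y.
  by move=> Ay; apply: (class_C1_differentiable_scalar oB _ Ay); exact: class_C_le Cf.
split=> [x Ax|x w Ax|w].
- by apply: continuous_comp; [exact: cg|apply: cf; exact: AB].
- apply/diff_derivable/differentiable_comp; first exact: dg.
  by apply: df; exact: AB.
- have : class_C n A (fun x => \sum_i 'D_w g x 0 i * ('D_(delta_mx 0 i) f \o g) x).
    apply: class_C_sum => // i; apply: class_CM => //.
      by have /class_C_rowP := Dg w; exact.
    by apply: IH; [exact: AB|exact: class_CS|exact: Df].
  apply: class_C_ext => // x Ax.
  have dfx : differentiable f (g x) by apply: df; exact: AB.
  by rewrite (derive_comp _ (dg _ Ax) dfx) [RHS](derive_basis _ dfx).
Qed.

Lemma smooth_comp_scalar k m (A : set 'rV[R]_k) (B : set 'rV[R]_m)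
    (g : 'rV[R]_k -> 'rV[R]_m) (f : 'rV[R]_m -> R) :
  open A -> open B -> (forall x, A x -> B (g x)) ->
  smooth A g -> smooth B f -> smooth A (f \o g).
Proof.
by move=> oA oB AB Cg Cf n; apply: class_C_comp_scalar (Cg n) (Cf n).
Qed.

Lemma smooth_comp k m l (A : set 'rV[R]_k) (B : set 'rV[R]_m)
    (g : 'rV[R]_k -> 'rV[R]_m) (f : 'rV[R]_m -> 'rV[R]_l) :
  open A -> open B -> (forall x, A x -> B (g x)) ->
  smooth A g -> smooth B f -> smooth A (f \o g).
Proof.
move=> oA oB AB Cg /(smooth_rowP _ oB) Cf; apply/smooth_rowP => // i.
exact: (smooth_comp_scalar oA oB AB Cg (Cf i)).
Qed.

End rows.
(** * Hadamard's lemma *)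

Section unit_integral.
Context {R : realType}.
Notation mu := (@lebesgue_measure R).
Implicit Types f g F : R -> R.

Definition unit_integral f : R := \int[mu]_(s in `[0, 1]) f s.

Definition continuous01 f := forall s : R, 0 <= s <= 1 -> {for s, continuous f}.

Lemma continuous01_within f : continuous01 f -> {within `[0, 1], continuous f}.
Proof.
move=> cf; apply: continuous_in_subspaceT => s; rewrite inE /= in_itv /=.
exact: cf.
Qed.

Lemma continuous01_integrable f : continuous01 f ->
  mu.-integrable `[0, 1] (EFin \o f).
Proof.
move=> cf; apply: continuous_compact_integrable; first exact: segment_compact.
exact: continuous01_within.
Qed.

Lemma unit_integralD f g : continuous01 f -> continuous01 g ->
  unit_integral (fun s => f s + g s) = unit_integral f + unit_integral g.
Proof.
by move=> cf cg; apply: RintegralD => //; exact: continuous01_integrable.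
Qed.

Lemma unit_integralB f g : continuous01 f -> continuous01 g ->
  unit_integral (fun s => f s - g s) = unit_integral f - unit_integral g.
Proof.
by move=> cf cg; apply: RintegralB => //; exact: continuous01_integrable.
Qed.

Lemma unit_integralZ c f : continuous01 f ->
  unit_integral (fun s => c * f s) = c * unit_integral f.
Proof. by move=> cf; apply: RintegralZl => //; exact: continuous01_integrable. Qed.

Lemma unit_integral_norm_le f e : continuous01 f ->
  (forall s : R, 0 <= s <= 1 -> `|f s| <= e) -> `|unit_integral f| <= e.
Proof.
move=> cf fe.
have intf := continuous01_integrable cf.
rewrite (le_trans (le_normr_Rintegral _ intf)) //.
have -> : e = \int[mu]_(s in `[0, 1]) e.
  rewrite Rintegral_cst //= lebesgue_measure_itv /= lte_fin ltr01 oppr0 adde0.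
  by rewrite mulr1.
have intn : mu.-integrable `[0, 1] (EFin \o (fun s => `|f s|)).
  apply: continuous01_integrable => s s01.
  by apply: (@continuous_comp _ _ _ f Num.norm); [exact: cf|exact: norm_continuous].
have inte : mu.-integrable `[0, 1] (EFin \o (fun=> e)).
  by apply: continuous01_integrable => s _; exact: cvg_cst.
by apply: le_Rintegral => // s; rewrite /= in_itv /=; exact: fe.
Qed.

Lemma unit_integral_derivative f F : continuous01 f ->
  (forall s : R, 0 <= s <= 1 -> is_derive s 1 F (f s)) -> unit_integral f = F 1 - F 0.
Proof.
move=> cf dF.
have cF (s : R) : 0 <= s <= 1 -> {for s, continuous F}.
  by move=> /dF[dFs _]; apply/differentiable_continuous/derivable1_diffP.
rewrite /unit_integral /Rintegral (@continuous_FTC2 _ f F) //.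
- exact: continuous01_within.
- split.
  + by move=> s /subset_itv_oo_cc; rewrite in_itv /= => /dF[].
  + by apply: cvg_at_right_filter; apply: cF; rewrite lexx ler01.
  + by apply: cvg_at_left_filter; apply: cF; rewrite lexx ler01.
- by move=> s /subset_itv_oo_cc; rewrite in_itv /= derive1E => /dF[].
Qed.

End unit_integral.

Section hadamard.
Context {R : realType} {n : nat}.
Local Notation V := 'rV[R]_n.+1.
Implicit Types (g : V -> R) (q w : V) (s r : R).

(** The first coordinate is multiplied by s; the formula is a sum, so its joint
    continuity in s and q is that of the vector space operations. *)
Definition shrink s q : V := q + ((s - 1) * q 0 0) *: delta_mx 0 0.

Lemma shrink_coord s q i : shrink s q 0 i = if i == 0 then s * q 0 0 else q 0 i.
Proof.
rewrite !mxE /=; case: eqP => [->|_]; last by rewrite mulr0 addr0.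
by rewrite mulr1 mulrBl mul1r addrC subrK.
Qed.

Lemma shrinkP s a w q : shrink s (a *: w + q) = a *: shrink s w + shrink s q.
Proof.
apply/rowP => i; rewrite [RHS]mxE [in RHS]mxE !shrink_coord !mxE.
by case: ifP => _ //; rewrite mulrDr mulrCA.
Qed.

Lemma shrink_norm s q : 0 <= s <= 1 -> `|shrink s q| <= `|q|.
Proof.
move=> /andP[s0 s1]; apply: row_norm_le => // i; rewrite shrink_coord.
case: ifP => _; last exact: row_coord_le.
rewrite normrM ger0_norm // (le_trans _ (row_coord_le q 0)) //.
exact: ler_piMl.
Qed.

Lemma ball0E r q : ball (0 : V) r q <-> `|q| < r.
Proof. by rewrite -ball_normE /ball_ /= sub0r normrN. Qed.

Lemma shrink_ball r s q : 0 <= s <= 1 -> ball (0 : V) r q -> ball (0 : V) r (shrink s q).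
Proof. by move=> s01 /ball0E qr; apply/ball0E/(le_lt_trans (shrink_norm q s01)). Qed.

Lemma shrink_continuous (z : R * V) :
  {for z, continuous (fun z : R * V => shrink z.1 z.2)}.
Proof.
have c1 : {for z, continuous (fun z : R * V => z.1)} by exact: cvg_fst.
have c2 : {for z, continuous (fun z : R * V => z.2)} by exact: cvg_snd.
have c20 : {for z, continuous (fun z : R * V => z.2 0 0)}.
  by have /continuous_rowP := c2; exact.
apply: cvgD => //; apply: cvgZr_tmp; apply: cvgM => //.
by apply: cvgB => //; exact: cvg_cst.
Qed.

Lemma shrink_path_continuous q s : {for s, continuous (fun s => shrink s q)}.
Proof.
apply: cvgD; first exact: cvg_cst.
apply: cvgZr_tmp; apply: cvgM; last exact: cvg_cst.
by apply: cvgB; [exact: cvg_id|exact: cvg_cst].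
Qed.

(** The average of g over the segment from the hyperplane q 0 0 = 0 to q. The weight
    s ^+ k makes the family of these averages stable under differentiation: each
    derivative along the first coordinate brings out one more factor s. *)
Definition ray_average (k : nat) g q : R :=
  unit_integral (fun s => s ^+ k * g (shrink s q)).

Section ball.
Variable r : R.
Local Notation A := (ball (0 : V) r).

Let A_open : open A. Proof. exact: ball_open. Qed.

Lemma ray_continuous g q : class_C 0 A g -> A q ->
  continuous01 (fun s => g (shrink s q)).
Proof.
move=> cg Aq s s01.
apply: (@continuous_comp _ _ _ (fun s => shrink s q) g).
  exact: shrink_path_continuous.
by apply: cg; exact: shrink_ball.
Qed.

Lemma ray_continuous01 k g q : class_C 0 A g -> A q ->
  continuous01 (fun s => s ^+ k * g (shrink s q)).
Proof.
by move=> cg Aq s s01; apply: cvgM; [exact: exprn_continuous|exact: ray_continuous].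
Qed.

(** Compactness of the segment of parameters makes the continuity uniform in s. *)
Lemma shrink_uniform g q e : class_C 0 A g -> A q -> 0 < e ->
  \forall q' \near q, A q' /\
    forall s, 0 <= s <= 1 -> `|g (shrink s q) - g (shrink s q')| <= e.
Proof.
move=> cg Aq e0; have nA : nbhs q A by exact: open_nbhs_nbhs.
have /compact_near_coveringP/(_ V (nbhs q)
    (fun q' s => `|g (shrink s q) - g (shrink s q')| <= e)) := @segment_compact R 0 1.
have cover s : `[0, 1]%classic s ->
    \forall s' \near s & q' \near q, `|g (shrink s' q) - g (shrink s' q')| <= e.
  rewrite /= in_itv /= => s01.
  have cgs : {for (s, q), continuous (fun z : R * V => g (shrink z.1 z.2))}.
    apply: (@continuous_comp _ _ _ (fun z : R * V => shrink z.1 z.2) g).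
      exact: shrink_continuous.
    by apply: cg; exact: shrink_ball.
  have cgs0 : {for s, continuous (fun s => g (shrink s q))}.
    apply: (@continuous_comp _ _ _ (fun s => shrink s q) g).
      exact: shrink_path_continuous.
    by apply: cg; exact: shrink_ball.
  have e20 : 0 < e / 2 by rewrite divr_gt0.
  have /cvgrPdist_le/(_ _ e20) [[P Q] /= [nP nQ] PQ] := cgs.
  have /cvgrPdist_le/(_ _ e20) nS := cgs0.
  exists (P `&` [set s' | `|g (shrink s q) - g (shrink s' q)| <= e / 2], Q).
    by split=> //=; exact: filterI.
  move=> [s' q'] /= [[Ps' H1] Qq'].
  have := PQ (s', q') (conj Ps' Qq') => /= H2.
  rewrite -(subrKA (g (shrink s q))) (le_trans (ler_normD _ _)) //.
  by rewrite (splitr e) lerD // distrC.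
by move=> /(_ _ cover); apply: filterS2 nA.
Qed.

Lemma ray_average_continuous k g : class_C 0 A g -> class_C 0 A (ray_average k g).
Proof.
move=> cg q Aq.
apply/continuous_distP => e e0.
apply: filterS (shrink_uniform cg Aq e0) => q' [Aq' H].
rewrite -unit_integralB; [|exact: ray_continuous01..].
apply: unit_integral_norm_le.
  by move=> s s01; apply: cvgB; exact: ray_continuous01.
move=> s /[dup] s01 /andP[s0 s1]; rewrite -mulrBr normrM -[leRHS]mul1r.
apply: ler_pM => //; last exact: H.
by rewrite ger0_norm ?exprn_ge0 // exprn_ile1.
Qed.

Let rest w : V := w - w 0 0 *: delta_mx 0 0.

Lemma derive_shrink g s q w : class_C 1 A g -> A q ->
  'D_(shrink s w) g q = s * w 0 0 * 'D_(delta_mx 0 0) g q + 'D_(rest w) g q.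
Proof.
move=> Cg Aq; have dg := class_C1_differentiable_scalar A_open Cg Aq.
have -> : shrink s w = (s * w 0 0) *: delta_mx 0 0 + rest w.
  apply/rowP => i; rewrite shrink_coord !mxE /=; case: eqP => [->|_].
    by rewrite !mulr1 subrr addr0.
  by rewrite !mulr0 subr0 add0r.
by rewrite !deriveE // linearD linearZ.
Qed.

(** Differentiation under the integral sign: by the mean value theorem, the
    difference quotient of the integrand differs from its derivative by an increment
    of partial derivatives of g, which is small uniformly in s. *)
Lemma ray_average_derive k g q w : class_C 1 A g -> A q ->
  is_derive q w (ray_average k g)
    (w 0 0 * ray_average k.+1 ('D_(delta_mx 0 0) g) q + ray_average k ('D_(rest w) g) q).
Proof.
move=> Cg Aq; have [_ dg Dg] := Cg.
have cg : class_C 0 A g by exact: class_CS Cg.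
have c0 : class_C 0 A ('D_(delta_mx 0 0) g) := Dg _.
have c1 : class_C 0 A ('D_(rest w) g) := Dg _.
set L := (X in is_derive _ _ _ X).
pose dir s y := s * w 0 0 * 'D_(delta_mx 0 0) g y + 'D_(rest w) g y.
have cdir k' y : A y -> continuous01 (fun s => s ^+ k' * dir s (shrink s y)).
  move=> Ay s s01; apply: cvgM; first exact: exprn_continuous.
  apply: cvgD; last exact: (ray_continuous c1 Ay s01).
  apply: cvgM; last exact: (ray_continuous c0 Ay s01).
  by apply: cvgM; [exact: cvg_id|exact: cvg_cst].
have rc0 := ray_continuous01 (k:=k.+1) c0 Aq; have rc1 := ray_continuous01 (k:=k) c1 Aq.
have rcg y (Ay : A y) := ray_continuous01 (k:=k) cg Ay.
have LE : L = unit_integral (fun s => s ^+ k * dir s (shrink s q)).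
  rewrite /L /ray_average -unit_integralZ // -unit_integralD //; last first.
    by move=> s s01; apply: cvgM; [exact: cvg_cst|exact: rc0].
  by congr unit_integral; apply/funext => s; rewrite /dir exprS; ring.
suff lim : (fun h : R => h^-1 *: ((ray_average k g \o shift q) (h *: w) - ray_average k g q))
    @ 0^' --> L.
  split; [by apply/cvg_ex; exists L|exact: cvg_lim].
apply/cvgrPdist_le => e e0.
have e20 : 0 < e / (`|w 0 0| + 1) by rewrite divr_gt0 // ltr_wpDl.
have : \forall q' \near q, A q' /\ forall s, 0 <= s <= 1 ->
    `|'D_(delta_mx 0 0) g (shrink s q) - 'D_(delta_mx 0 0) g (shrink s q')|
      <= e / (`|w 0 0| + 1) /\
    `|'D_(rest w) g (shrink s q) - 'D_(rest w) g (shrink s q')| <= e / (`|w 0 0| + 1).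
  apply: filterS2 (shrink_uniform c0 Aq e20) (shrink_uniform c1 Aq e20).
  by move=> q' [Aq' H0] [_ H1]; split=> // s s01; split; [exact: H0|exact: H1].
move=> /nbhs_ballP[d /= d0 Hd].
have : \forall h \near (0 : R)^', `|h| < d / (`|w| + 1).
  by apply: dnbhs0_lt; rewrite divr_gt0 // ltr_wpDl.
have h0 : \forall h \near (0 : R)^', h != 0 by exact: nbhs_dnbhs_neq.
move: h0; apply: filterS2 => h h0 hd.
have near_q (t : R) : `|t| <= `|h| -> ball q d (t *: w + q).
  move=> th; rewrite -ball_normE /ball_ /= opprD addrCA subrr addr0 normrN normrZ.
  rewrite (le_lt_trans (ler_wpM2r _ th)) //.
  move: hd; rewrite ltr_pdivlMr ?ltr_wpDl //; apply: le_lt_trans.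
  by apply: ler_wpM2l => //; rewrite lerDl.
have Ahq : A (h *: w + q) by have [] := Hd _ (near_q h (lexx _)).
rewrite LE /ray_average /= -unit_integralB; [|exact: rcg..].
have scE (a b : R) : a *: b = a * b by [].
rewrite scE -unit_integralZ; last first.
  by move=> s s01; apply: cvgB; [exact: (rcg _ Ahq)|exact: rcg].
rewrite -unit_integralB; [|exact: cdir|]; last first.
  by move=> s s01; apply: cvgM; [exact: cvg_cst|apply: cvgB; [exact: (rcg _ Ahq)|exact: rcg]].
apply: unit_integral_norm_le.
  move=> s s01; apply: cvgB; first exact: (cdir _ _ Aq s s01).
  by apply: cvgM; [exact: cvg_cst|apply: cvgB; [exact: (rcg _ Ahq)|exact: rcg]].
move=> s /[dup] s01 /andP[s0 s1].
rewrite shrinkP.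
have [|t th E] := @MVT_line _ _ g (shrink s q) (shrink s w) h.
  move=> t /near_q/Hd[At _]; apply: dg; rewrite -shrinkP.
  exact: shrink_ball.
have [At /(_ s s01)[H0 H1]] := Hd _ (near_q _ th).
rewrite -mulrBr E mulrCA mulKf // -mulrBr normrM -[leRHS]mul1r.
apply: ler_pM => //; first by rewrite ger0_norm ?exprn_ge0 // exprn_ile1.
rewrite -shrinkP derive_shrink //; last exact: shrink_ball.
rewrite /dir opprD addrACA -mulrBr (le_trans (ler_normD _ _)) //.
have -> : e = `|w 0 0| * (e / (`|w 0 0| + 1)) + e / (`|w 0 0| + 1).
  by field; rewrite gt_eqF // ltr_wpDl.
apply: lerD => //.
rewrite normrM; apply: ler_pM => //.
by rewrite normrM ger0_norm // ler_piMl.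
Qed.

Lemma class_C_ray_average k m g : class_C m A g -> class_C m A (ray_average k g).
Proof.
elim: m k g => [|m IH] k g Cg; first exact: ray_average_continuous.
have [_ dg Dg] := Cg; have cg : class_C 0 A g by exact: class_C_le Cg.
have dJ q w (Aq : A q) := ray_average_derive k w (class_C_le (ltn0Sn m) Cg) Aq.
split=> [q Aq|q w Aq|w].
- exact: (ray_average_continuous (k:=k) cg).
- by have [] := dJ q w Aq.
- have C : class_C m A (fun q => w 0 0 * ray_average k.+1 ('D_(delta_mx 0 0) g) q +
      ray_average k ('D_(rest w) g) q).
    apply: class_CD (IH _ _ (Dg _)) => //.
    by apply: class_CM (IH _ _ (Dg _)) => //; exact: class_C_cst.
  by apply: class_C_ext C => // q Aq; have [_ ->] := dJ q w Aq.
Qed.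

(** The quotient is the average of the first partial derivative of g over the segment
    from the hyperplane to the point. *)
Lemma hadamard g : smooth A g -> (forall q, A q -> q 0 0 = 0 -> g q = 0) ->
  exists alpha : V -> R, smooth A alpha /\ forall q, A q -> g q = q 0 0 * alpha q.
Proof.
move=> Cg g0; exists (ray_average 0 ('D_(delta_mx 0 0) g)); split.
  by move=> m; apply: class_C_ray_average; exact: smooth_derive.
move=> q Aq; have C0 := smooth_derive (delta_mx 0 0) Cg.
have c0 : class_C 0 A ('D_(delta_mx 0 0) g) by exact: C0.
rewrite /ray_average -unit_integralZ; last exact: (ray_continuous01 (k:=0) c0 Aq).
pose e1 : V := q 0 0 *: delta_mx 0 0.
have shE s : shrink s q = s *: e1 + (q - e1).
  by rewrite /shrink /e1 scalerA mulrBl mul1r scalerBl addrC -!addrA [- _ + q]addrC.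
set f := (X in unit_integral X).
have -> : unit_integral f = g (shrink 1 q) - g (shrink 0 q).
  apply: (@unit_integral_derivative _ f (fun s => g (shrink s q))).
    move=> s s01; apply: cvgM; first exact: cvg_cst.
    exact: (ray_continuous01 (k:=0) c0 Aq s01).
  move=> s s01; rewrite /f expr0 mul1r.
  have Asq : A (s *: e1 + (q - e1)) by rewrite -shE; exact: shrink_ball.
  have -> : q 0 0 * 'D_(delta_mx 0 0) g (shrink s q) = 'D_e1 g (s *: e1 + (q - e1)).
    have dg := smooth_differentiable_scalar A_open Cg Asq.
    by rewrite shE (deriveE (delta_mx 0 0) dg) (deriveE e1 dg) [in RHS]linearZ.
  have -> : (fun s => g (shrink s q)) = (fun s => g (s *: e1 + (q - e1))).
    by apply/funext => x; rewrite shE.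
  by apply: is_derive_line; apply: smooth_derivable Asq.
have -> : shrink 1 q = q by rewrite /shrink subrr mul0r scale0r addr0.
rewrite (g0 (shrink 0 q)) ?subr0 //; last by rewrite shrink_coord eqxx mul0r.
by apply: shrink_ball => //; rewrite lexx ler01.
Qed.

End ball.
End hadamard.
(** * Rigidity of the symmetry in the normal form *)

Section plane.
Context {R : realType}.

Definition row2 (u v : R) : 'rV[R]_2 := \row_(j < 2) [:: u; v]`_j.

Lemma row2_0 u v : row2 u v 0 0 = u. Proof. by rewrite mxE. Qed.

Lemma row2_1 u v : row2 u v 0 1 = v. Proof. by rewrite mxE. Qed.

Lemma row2P (q q' : 'rV[R]_2) : q 0 0 = q' 0 0 -> q 0 1 = q' 0 1 -> q = q'.
Proof.
move=> q0 q1; apply/rowP => j; case: j => -[|[|//]] lt_j2.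
  by rewrite (_ : Ordinal lt_j2 = 0) //; exact/val_inj.
by rewrite (_ : Ordinal lt_j2 = 1) //; exact/val_inj.
Qed.

Lemma row2_eta (q : 'rV[R]_2) : q = row2 (q 0 0) (q 0 1).
Proof. by apply: row2P; rewrite ?row2_0 ?row2_1. Qed.

Lemma row2_norm_le u v (d : R) : `|u| <= d -> `|v| <= d -> `|row2 u v| <= d.
Proof.
move=> ud vd; apply: row_norm_le => [|i]; first exact: le_trans ud.
by rewrite mxE; case: i => -[|[|//]] /= _.
Qed.

Lemma row2_continuous v (u : R) : {for u, continuous (fun u => row2 u v)}.
Proof.
apply/continuous_distP => e e0; near=> u'.
rewrite row_norm_le ?ltW // => i; rewrite !mxE.
case: i => -[|[|//]] /= _; last by rewrite subrr normr0 ltW.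
near: u'; exact: cvgr_dist_le.
Unshelve. all: by end_near. Qed.

End plane.

Section rigidity.
Context {R : realType}.

(** The derivative of b is small compared with its argument, so b is Lipschitz on
    a small interval with a constant that is small compared with its length. *)
Lemma flat_lipschitz (b : R -> R) (e : R) :
  smooth_near 0 b -> (b^`())%classic 0 = 0 -> (b^`(2))%classic 0 = 0 -> 0 < e ->
  exists2 r : R, 0 < r & forall rho x y, rho <= r -> `|x| <= rho -> `|y| <= rho ->
    `|b x - b y| <= e * rho * `|x - y|.
Proof.
move=> [A [oA A0 Cb]] b1 b2 e0.
have db x : A x -> derivable b x 1 by move=> Ax; exact: smooth_derivable Ax.
have dDb : derivable ('D_1 b) 0 1 by apply: smooth_derivable A0; exact: smooth_derive.
have Db0 : 'D_1 b 0 = 0 by rewrite -derive1E.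
have DDb0 : 'D_1 ('D_1 b) 0 = 0.
  have -> : 'D_1 b = (b^`())%classic by apply/funext => x; rewrite derive1E.
  by rewrite -derive1E; exact: b2.
have : \forall h \near (0 : R), A h /\ `|'D_1 b h| <= e * `|h|.
  have nA : nbhs (0 : R) A by exact: open_nbhs_nbhs.
  have /eqaddoP/(_ _ e0) := derivable_nbhs dDb.
  apply: filterS2 nA => h Ah; rewrite !fctE /= addr0 [h%:A]mulr1 DDb0 Db0.
  by rewrite scaler0 addr0 subr0.
move=> /nbhs_norm0P[r /= r0 Hr].
exists (r / 2); first by rewrite divr_gt0.
move=> rho x y rhor xr yr.
have inA z : `|z| <= rho -> A z /\ `|'D_1 b z| <= e * `|z|.
  by move=> zr; apply: Hr; rewrite /= (le_lt_trans zr) // (le_lt_trans rhor) //; lra.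
wlog xy : x y xr yr / y <= x.
  move=> W; have [yx|/ltW xy] := leP y x; first exact: W.
  by rewrite distrC [`|x - y|]distrC; exact: W.
have zr z : z \in `[y, x] -> `|z| <= rho.
  move: xr yr; rewrite in_itv /= !ler_norml => /andP[? ?] /andP[? ?] /andP[? ?].
  by apply/andP; split; lra.
have [||c /zr cr ->] := @MVT_segment _ b ('D_1 b) y x xy.
- by move=> z /subset_itv_oo_cc/zr/inA[/db dbz _].
- by apply: derivable_within_continuous => z /zr/inA[/db].
have [_ Dc] := inA c cr.
rewrite normrM; apply: ler_wpM2r => //.
by rewrite (le_trans Dc) // ler_wpM2l // ltW.
Qed.

(** Put w = v + V, so that u w = b (w - v) - b v. For fixed v, let u vary over
    [-d, d], where d is twice a Lipschitz constant of b. At both ends the term u w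
    dominates b (w - v) - b (-v). If b (-v) <> b v, then w never vanishes, hence keeps
    its sign, whereas the equations at the two ends give opposite signs to
    b (-v) - b v. So b (-v) = b v, and w vanishes at the ends. Finally a nonzero value
    of w determines u, so the value w u0 / 2 cannot be taken on both sides of u0. *)
Lemma symmetry_rigidity (b : R -> R) (V : 'rV[R]_2 -> R) (C : R) :
  (forall e : R, 0 < e -> exists2 r : R, 0 < r &
    forall rho x y, rho <= r -> `|x| <= rho -> `|y| <= rho ->
    `|b x - b y| <= e * rho * `|x - y|) ->
  (\forall q \near (0 : 'rV[R]_2), {for q, continuous V}) ->
  (\forall q \near (0 : 'rV[R]_2), `|V q| <= C * `|q|) ->
  (\forall q \near (0 : 'rV[R]_2),
    b (V q) - q 0 0 * V q = q 0 0 * q 0 1 + b (q 0 1)) ->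
  \forall q \near (0 : 'rV[R]_2), V q = - q 0 1 /\ b (q 0 1) = b (- q 0 1).
Proof.
move=> blip cV VC eqV.
(* Taking K >= 1 puts - v, like V, in the interval [- K d, K d]. *)
pose K := Num.max C 1.
have K1 : 1 <= K by rewrite le_max lexx orbT.
have K0 : 0 < K by rewrite (lt_le_trans ltr01).
have CK : C <= K by rewrite le_max lexx.
have e0 : 0 < 1 / (2 * K) by rewrite divr_gt0 // mulr_gt0.
have [r r0 Hr] := blip _ e0.
have : \forall q \near (0 : 'rV[R]_2), [/\ {for q, continuous V},
    `|V q| <= C * `|q| & b (V q) - q 0 0 * V q = q 0 0 * q 0 1 + b (q 0 1)].
  by apply: filterS3 cV VC eqV => q ? ? ?; split.
move=> /nbhs_norm0P[d1 /= d10 Hd1].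
pose d := Num.min (d1 / 2) (r / K).
have d0 : 0 < d by rewrite lt_min !divr_gt0.
have dd1 : d < d1 by rewrite gt_min; apply/orP; left; lra.
have dr : K * d <= r by rewrite mulrC -ler_pdivlMr // ge_min lexx orbT.
have dKd : d <= K * d by rewrite ler_peMl // ltW.
have Hd q : `|q| <= d -> [/\ {for q, continuous V}, `|V q| <= K * d &
    b (V q) - q 0 0 * V q = q 0 0 * q 0 1 + b (q 0 1)].
  move=> qd; have [|c1 c2 c3] := Hd1 q; first exact: le_lt_trans qd dd1.
  by split=> //; rewrite (le_trans c2) // (le_trans (ler_wpM2r _ CK)) // ler_wpM2l // ltW.
have lip x y : `|x| <= K * d -> `|y| <= K * d -> `|b x - b y| <= d / 2 * `|x - y|.
  move=> xd yd; rewrite (le_trans (Hr _ x y dr xd yd)) //.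
  by apply: ler_wpM2r => //; rewrite le_eqVlt; apply/orP; left; apply/eqP; field; rewrite gt_eqF.
apply/nbhs_norm0P; exists d => //= q qd.
have ud : `|q 0 0| <= d by rewrite (le_trans (row_coord_le q 0)) // ltW.
have vd : `|q 0 1| <= d by rewrite (le_trans (row_coord_le q 1)) // ltW.
rewrite {1}(row2_eta q); move: (q 0 0) (q 0 1) ud vd => u0 v u0d vd {q qd}.
pose w u := v + V (row2 u v).
have itvd u : - d <= u <= d -> `|row2 u v| <= d.
  by move=> ud; apply: row2_norm_le => //; rewrite ler_norml.
have cw (x y : R) : - d <= x -> y <= d -> {within `[x, y], continuous w}.
  move=> dx yd; apply: continuous_in_subspaceT => u; rewrite inE /= in_itv /= => /andP[xu uy].
  apply: cvgD; first exact: cvg_cst.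
  apply: (@continuous_comp _ _ _ (fun u => row2 u v) V); first exact: row2_continuous.
  by have [] := Hd (row2 u v); first by apply: itvd; rewrite (le_trans dx) // (le_trans uy).
have eqw u : - d <= u <= d -> u * w u = b (w u - v) - b v.
  move=> ud; have [_ _] := Hd _ (itvd u ud).
  rewrite row2_0 row2_1 /w addrAC subrr add0r => E; lra.
have lipw u : - d <= u <= d -> `|b (w u - v) - b (- v)| <= d / 2 * `|w u|.
  move=> ud; have [_ Vd _] := Hd _ (itvd u ud).
  rewrite (le_trans (lip _ _ _ _)) //.
  - by rewrite /w addrAC subrr add0r.
  - by rewrite normrN (le_trans vd).
  - by rewrite opprK subrK.
have dd : - d <= d <= d by rewrite lexx andbT; lra.
have dN : - d <= - d <= d by rewrite lexx /=; lra.
have even_b : b v = b (- v).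
  apply/eqP; apply/negP => /negP bv.
  have w0 u : - d <= u <= d -> w u != 0.
    move=> ud; apply: contra bv => /eqP wu; have := eqw u ud.
    by rewrite wu mulr0 sub0r => E; apply/eqP; lra.
  have [||c] := @IVT _ w (- d) d 0 _ (cw _ _ (lexx _) (lexx _)); first lra.
    have := eqw _ dd; have := eqw _ dN; have := lipw _ dd; have := lipw _ dN.
    have := w0 _ dd; have := w0 _ dN.
    rewrite ge_min le_max !ler_norml.
    case: (ltgtP (w (- d)) 0) => // wN _; case: (ltgtP (w d) 0) => // wP _ /=.
    - rewrite (ltr0_norm wN) (ltr0_norm wP) => /andP[? ?] /andP[? ?] ? ?.
      have ? : 0 < d * - w d by rewrite mulr_gt0 // oppr_gt0.
      have ? : 0 < d * - w (- d) by rewrite mulr_gt0 // oppr_gt0.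
      lra.
    - rewrite (gtr0_norm wN) (gtr0_norm wP) => /andP[? ?] /andP[? ?] ? ?.
      have ? : 0 < d * w d by rewrite mulr_gt0.
      have ? : 0 < d * w (- d) by rewrite mulr_gt0.
      lra.
  by rewrite in_itv /= => /w0/eqP.
split=> //.
have wend u : `|u| = d -> w u = 0.
  move=> ud; have du : - d <= u <= d by rewrite -ler_norml ud.
  have := lipw u du; rewrite -even_b -eqw // normrM ud => H.
  apply/eqP; rewrite -normr_le0; nra.
suff : w u0 = 0 by rewrite /w => E; lra.
apply/eqP; apply/negP => /negP m0.
have u0d' : - d <= u0 <= d by rewrite -ler_norml.
have [du0 u0d2] := andP u0d'.
have wd : w d = 0 by apply: wend; rewrite gtr0_norm.
have wNd : w (- d) = 0 by apply: wend; rewrite normrN gtr0_norm.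
have mid : Num.min 0 (w u0) <= w u0 / 2 <= Num.max 0 (w u0).
  by rewrite ge_min le_max; case: (ltgtP (w u0) 0) m0 => //= ? _; apply/andP; split; lra.
have [|u1] := @IVT _ w (- d) u0 (w u0 / 2) du0 (cw _ _ (lexx _) u0d2).
  by rewrite wNd.
rewrite in_itv /= => /andP[du1 u1u0] E1.
have [|u2] := @IVT _ w u0 d (w u0 / 2) u0d2 (cw _ _ du0 (lexx _)).
  by rewrite wd minC maxC.
rewrite in_itv /= => /andP[u0u2 u2d] E2.
have e1 : u1 * (w u0 / 2) = b (w u0 / 2 - v) - b v.
  by rewrite -E1 eqw // du1 (le_trans u1u0).
have e2 : u2 * (w u0 / 2) = b (w u0 / 2 - v) - b v.
  by rewrite -E2 eqw // u2d (le_trans _ u0u2).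
have m20 : w u0 / 2 != 0 by rewrite mulf_neq0 // invr_neq0.
have u12 : u1 = u2 by apply: (mulIf m20); rewrite e1 e2.
have u10 : u1 = u0 by apply/eqP; rewrite eq_le u1u0 u12.
move: E1; rewrite u10 => E; move/eqP: m0; apply; lra.
Qed.

End rigidity.
(** * From an involution in a chart to a symmetry of the map *)

Lemma open_preimage_in (T1 T2 : topologicalType) (A : set T1) (B : set T2)
    (f : T1 -> T2) :
  open A -> open B -> (forall x, A x -> {for x, continuous f}) ->
  open (A `&` f @^-1` B).
Proof.
move=> oA oB cf; rewrite openE => x [Ax Bfx]; apply: filterI.
  exact: open_nbhs_nbhs.
by apply: (cf x Ax); exact: open_nbhs_nbhs.
Qed.

Lemma ball0_connected (R : realType) (V : normedModType R) (r : R) :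
  0 < r -> connected (ball (0 : V) r).
Proof.
move=> r0; pose seg (q : V) := (fun s : R => s *: q) @` `[0, 1].
have -> : ball (0 : V) r = \bigcup_(q in ball (0 : V) r) seg q.
  apply/seteqP; split=> [q Bq|_ [q Bq [s s01 <-]]].
    by exists q => //; exists 1; rewrite /= ?scale1r // in_itv /= lexx ler01.
  move: s01 Bq; rewrite /= in_itv /= -!ball_normE /ball_ /= !sub0r !normrN normrZ.
  by move=> /andP[s0 s1]; apply: le_lt_trans; rewrite ger0_norm // ler_piMl.
apply: bigcup_connected.
  by exists 0 => q Bq; exists 0; rewrite ?scale0r // /= in_itv /= lexx ler01.
move=> q Bq; apply: connected_continuous_connected; first exact: segment_connected.
by apply: continuous_subspaceT => s; exact: scalel_continuous.
Qed.

Section jacobians.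
Context {R : realType}.

Lemma jacobianE n m (h : 'rV[R]_n -> 'rV[R]_m) x i j :
  differentiable h x -> 'J h x i j = 'D_(delta_mx 0 i) h x 0 j.
Proof.
by move=> dh; rewrite deriveEjacobian // -rowE [RHS]mxE.
Qed.

Lemma jacobian_eq n m (h : 'rV[R]_n -> 'rV[R]_m) x (M : 'M[R]_(n, m)) :
  differentiable h x -> (forall w, 'D_w h x = w *m M) -> 'J h x = M.
Proof.
move=> dh hM; apply/matrixP => i j; rewrite jacobianE // hM -rowE.
by rewrite mxE.
Qed.

Lemma jacobian_comp n m l (g : 'rV[R]_n -> 'rV[R]_m) (f : 'rV[R]_m -> 'rV[R]_l) x :
  differentiable g x -> differentiable f (g x) ->
  'J (f \o g) x = 'J g x *m 'J f (g x).
Proof.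
move=> dg df; apply: jacobian_eq => [|w]; first exact: differentiable_comp.
by rewrite derive_comp // mulmxA -!deriveEjacobian.
Qed.

Lemma jacobian_near_id n (h : 'rV[R]_n -> 'rV[R]_n) x :
  differentiable h x -> (\forall y \near x, h y = y) -> 'J h x = 1%:M.
Proof.
move=> dh hid; apply: jacobian_eq => // w; rewrite mulmx1.
by rewrite (near_eq_derive _ hid) derive_id.
Qed.

Lemma jacobian_inverse n (h k : 'rV[R]_n -> 'rV[R]_n) x :
  differentiable h x -> differentiable k (h x) ->
  (\forall y \near x, k (h y) = y) -> 'J h x *m 'J k (h x) = 1%:M.
Proof.
move=> dh dk kh; rewrite -jacobian_comp //.
by apply: jacobian_near_id => //; exact: differentiable_comp.
Qed.

Lemma class_C_prod (V : normedModType R) n (A : set V) (I : Type) (r : seq I)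
    (F : I -> V -> R) : open A ->
  (forall i, class_C n A (F i)) -> class_C n A (fun x => \prod_(i <- r) F i x).
Proof.
move=> oA CF; elim: r => [|i r IH].
  have C1 : class_C n A (cst 1 : V -> R) by exact: class_C_cst.
  by apply: class_C_ext C1 => // x _; rewrite big_nil.
by apply: class_C_ext (class_CM oA (CF i) IH) => // x _; rewrite big_cons.
Qed.

Lemma jacobian_det_continuous n (A : set 'rV[R]_n) (h : 'rV[R]_n -> 'rV[R]_n) :
  open A -> smooth A h -> class_C 0 A (fun x => \det ('J h x)).
Proof.
move=> oA Ch; rewrite /determinant.
have C : class_C 0 A (fun x => \sum_(s : 'S_n)
    (-1) ^+ s * \prod_i 'D_(delta_mx 0 i) h x 0 (s i)).
  apply: class_C_sum => // s; apply: class_CM => //; first exact: class_C_cst.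
  apply: class_C_prod => // i.
  by have /(smooth_rowP _ oA)/(_ (s i) 0%N) := smooth_derive (delta_mx 0 i) Ch.
apply: class_C_ext C => // x Ax; apply: eq_bigr => s _; congr (_ * _).
apply: eq_bigr => i _; rewrite jacobianE //.
exact: smooth_differentiable Ax.
Qed.

Lemma connected_nonzero_gt0 (V : normedModType R) (A : set V) (D : V -> R) p :
  connected A -> A p -> class_C 0 A D -> (forall x, A x -> D x != 0) ->
  0 < D p -> forall x, A x -> 0 < D x.
Proof.
move=> conA Ap cD D0 Dp x Ax; rewrite ltNge; apply/negP => Dx.
have : connected (D @` A).
  apply: connected_continuous_connected => //.
  by apply: continuous_in_subspaceT => y; rewrite inE; exact: cD.
move=> /connected_intervalP/(_ (D x) (D p)).
case/(_ _ _ 0) => [||| y /D0/eqP //]; [by exists x|by exists p|].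
by rewrite Dx ltW.
Qed.

End jacobians.

Lemma mul_eq1_neq0 (F : fieldType) (x y : F) : x * y = 1 -> x != 0.
Proof. by apply: contra_eq_neq => ->; rewrite mul0r eq_sym oner_neq0. Qed.

Lemma det_conj (F : fieldType) n (A B C : 'M[F]_n) :
  B *m A = 1%:M -> \det (A *m C *m B) = \det C.
Proof.
move=> BA; rewrite !det_mulmx mulrAC [_ * \det B]mulrC -det_mulmx BA det1.
by rewrite mul1r.
Qed.

Section charts.
Context {R : realType}.
Implicit Types (U N : set 'rV[R]_2) (p : 'rV[R]_2) (psi eta : 'rV[R]_2 -> 'rV[R]_2).

Lemma local_coordinatesP U p N psi : local_coordinates U p N psi ->
  [/\ open N, N 0, psi 0 = p & smooth N psi] /\
  exists k, [/\ open (psi @` N), smooth (psi @` N) k, psi @` N `<=` U,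
    (forall q, N q -> k (psi q) = q) & (forall x, (psi @` N) x -> psi (k x) = x)].
Proof.
move=> [N0 psi0 sub [oN oM Cpsi _ [k [Ck kpsi]]]]; split=> //.
by exists k; split=> // _ [q Nq <-]; rewrite kpsi.
Qed.

(** On a small ball B the involution is defined, and W is the image by psi of the
    union of B and eta B: this set is invariant, it is connected because both
    parts contain the origin, and it is open because eta B is also a preimage
    of B. The Jacobian determinant of an involution does not vanish, so on the
    connected set W it keeps the sign that it has at p. *)
Lemma symmetry_of_chart U p N psi A eta (f : 'rV[R]_2 -> 'rV[R]_3)
    (T : 'rV[R]_3 -> 'rV[R]_3) :
  local_coordinates U p N psi -> open A -> A 0 -> smooth A eta -> eta 0 = 0 ->
  0 < \det ('J eta 0) ->
  (\forall q \near (0 : 'rV[R]_2), eta (eta q) = q) ->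
  (\forall q \near (0 : 'rV[R]_2), f (psi (eta q)) = T (f (psi q))) ->
  has_symmetry U f p T.
Proof.
move=> /local_coordinatesP[[oN N0 psi0 Cpsi] [k [oM Ck sub kpsi psik]]].
move=> oA A0 Ceta eta0 deta inv_eta f_eta.
set M := psi @` N in oM Ck sub psik.
have cont_eta q : A q -> {for q, continuous eta} by exact: smooth_continuous.
have [r r0 Hr] : exists2 r : R, 0 < r & forall q, ball (0 : 'rV[R]_2) r q ->
    [/\ N q, A q, eta (eta q) = q & f (psi (eta q)) = T (f (psi q))].
  have nN : nbhs (0 : 'rV[R]_2) N by exact: open_nbhs_nbhs.
  have nA : nbhs (0 : 'rV[R]_2) A by exact: open_nbhs_nbhs.
  have : nbhs (0 : 'rV[R]_2) ((N `&` A) `&` ([set q | eta (eta q) = q] `&`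
      [set q | f (psi (eta q)) = T (f (psi q))])).
    by apply: filterI; exact: filterI.
  by move=> /nbhs_ballP[r /= r0 Hr]; exists r => // q /Hr[[? ?] [? ?]].
set B1 := ball (0 : 'rV[R]_2) r in Hr.
have oB1 : open B1 by exact: ball_open.
have B10 : B1 0 by exact: ballxx.
have [s s0 Hs] : exists2 s : R, 0 < s & forall q, ball (0 : 'rV[R]_2) s q ->
    B1 q /\ B1 (eta q).
  have nB : nbhs (0 : 'rV[R]_2) B1 by exact: open_nbhs_nbhs.
  have nBe : nbhs (0 : 'rV[R]_2) (eta @^-1` B1).
    by apply: (cont_eta _ A0); rewrite eta0.
  have /nbhs_ballP[s /= s0 Hs] : nbhs (0 : 'rV[R]_2) (B1 `&` eta @^-1` B1).
    exact: filterI.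
  by exists s => // q /Hs[].
set B := ball (0 : 'rV[R]_2) s in Hs.
have oB : open B by exact: ball_open.
have B0 : B 0 by exact: ballxx.
have etaB : eta @` B = B1 `&` eta @^-1` B.
  apply/seteqP; split=> [_ [q Bq <-]|q [B1q Beq]].
    have [B1q B1eq] := Hs q Bq; split=> //=.
    by have [_ _ -> _] := Hr q B1q.
  by exists (eta q) => //; have [_ _ -> _] := Hr q B1q.
pose Wt := B `|` eta @` B.
have Wt1 q : Wt q -> B1 q.
  by rewrite /Wt etaB => -[/Hs[]|[]].
have oWt : open Wt.
  rewrite /Wt etaB; apply: openU oB (open_preimage_in oB1 oB _) => q B1q.
  by apply: cont_eta; have [] := Hr q B1q.
have Wt_eta q : Wt q -> Wt (eta q).
  case=> [Bq|[q' Bq' <-]]; first by right; exists q.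
  have [B1q' _] := Hs q' Bq'.
  by have [_ _ -> _] := Hr q' B1q'; left.
have Wt0 : Wt 0 by left.
have WtN q : Wt q -> N q by move=> /Wt1/Hr[].
have WtA q : Wt q -> A q by move=> /Wt1/Hr[].
have conWt : connected Wt.
  apply: connectedU; first by exists 0; split=> //; exists 0.
    exact: ball0_connected.
  apply: connected_continuous_connected; first exact: ball0_connected.
  apply: continuous_in_subspaceT => q; rewrite inE => Bq; apply: cont_eta.
  by apply: WtA; left.
pose W := psi @` Wt.
have WM x : W x -> M x by move=> [q /WtN Nq <-]; exists q.
have kW x : W x -> Wt (k x) by move=> [q Wq <-]; rewrite kpsi //; exact: WtN.
have oW : open W.
  have -> : W = M `&` k @^-1` Wt.
    apply/seteqP; split=> [x Wx|x [Mx kx]]; first by split; [exact: WM|exact: kW].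
    by exists (k x) => //; exact: psik.
  by apply: (open_preimage_in oM oWt) => x Mx; exact: smooth_continuous Ck Mx.
have Wp : W p by exists 0.
pose phi x := psi (eta (k x)).
have phiW x : W x -> W (phi x) by move=> /kW Wk; exists (eta (k x)) => //; exact: Wt_eta.
have phiK x : W x -> phi (phi x) = x.
  move=> Wx; have Wk := kW x Wx; rewrite /phi kpsi; last exact/WtN/Wt_eta.
  by have [_ _ -> _] := Hr _ (Wt1 _ Wk); exact/psik/WM.
have Cphi : smooth W phi.
  have C1 : smooth W (eta \o k).
    by apply: (smooth_comp oW oWt) => //; [exact: smooth_sub Ck|exact: smooth_sub Ceta].
  apply: (smooth_comp oW oWt _ C1); last exact: smooth_sub Cpsi.
  by move=> x /kW/Wt_eta.
have kp : k p = 0 by rewrite -psi0 kpsi.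
have phip : phi p = p by rewrite /phi kp eta0.
have dphi x : W x -> differentiable phi x by exact: smooth_differentiable.
have dJ x : W x -> \det ('J phi x) != 0.
  move=> Wx; have := @jacobian_inverse _ _ phi phi x (dphi _ Wx) (dphi _ (phiW _ Wx))
    (near_of_open oW Wx phiK).
  move=> /(congr1 determinant); rewrite det_mulmx det1.
  by apply: mul_eq1_neq0.
have dk : differentiable k p by apply: (smooth_differentiable oM Ck); exact: WM.
have deta0 : differentiable eta 0 by exact: smooth_differentiable Ceta A0.
have dpsi : differentiable psi 0 by exact: smooth_differentiable Cpsi N0.
have Jp : \det ('J phi p) = \det ('J eta 0).
  have -> : 'J phi p = 'J k p *m 'J eta 0 *m 'J psi 0.
    have dek : differentiable (eta \o k) p by apply: differentiable_comp; rewrite ?kp.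
    have ekp : (eta \o k) p = 0 by rewrite /= kp.
    have dpsi' : differentiable psi ((eta \o k) p) by rewrite ekp.
    have deta' : differentiable eta (k p) by rewrite kp.
    by rewrite (jacobian_comp dek dpsi') (jacobian_comp dk deta') ekp kp.
  apply: det_conj; have := @jacobian_inverse _ _ psi k 0 dpsi.
  by rewrite psi0; apply; last exact: near_of_open oN N0 kpsi.
have conW : connected W.
  apply: connected_continuous_connected conWt _.
  apply: continuous_in_subspaceT => q; rewrite inE => /WtN Nq.
  exact: smooth_continuous Cpsi Nq.
have bij_phi : set_bij W W phi.
  split; [exact: phiW| |by move=> x Wx; exists (phi x); [exact: phiW|exact: phiK]].
  by move=> x y; rewrite !inE => Wx Wy /(congr1 phi); rewrite (phiK x Wx) (phiK y Wy).
have WU : W `<=` U by move=> x /WM/sub.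
have pos : orientation_preserving_on W phi.
  apply: (connected_nonzero_gt0 conW Wp (jacobian_det_continuous oW Cphi) dJ).
  by rewrite Jp.
have f_phi x : W x -> f (phi x) = T (f x).
  move=> Wx; have [_ _ _] := Hr _ (Wt1 _ (kW _ Wx)).
  by rewrite /phi (psik x (WM x Wx)).
exists W, phi; split; first by split; [exact: oW|exact: conW|exact: Wp|exact: WU].
split; [|exact: pos|exact: phip|exact: phiK|exact: f_phi].
by split; [exact: oW|exact: oW|exact: Cphi|exact: bij_phi|exists phi; split].
Qed.

End charts.
(** * Isometries and the tangent line *)

Section isometries.
Context {R : realType}.
Implicit Types (x y z t c : 'rV[R]_3) (S : 'rV[R]_3 -> 'rV[R]_3) (M : 'M[R]_3).

Lemma dotC x y : dot x y = dot y x.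
Proof. by apply: eq_bigr => i _; rewrite mulrC. Qed.

Lemma dotDl x y z : dot (x + y) z = dot x z + dot y z.
Proof. by rewrite /dot -big_split /=; apply: eq_bigr => i _; rewrite mxE mulrDl. Qed.

Lemma dotZl (a : R) x y : dot (a *: x) y = a * dot x y.
Proof. by rewrite /dot mulr_sumr; apply: eq_bigr => i _; rewrite mxE mulrA. Qed.

Lemma dotNl x y : dot (- x) y = - dot x y.
Proof. by rewrite -scaleN1r dotZl mulN1r. Qed.

Lemma dotDr x y z : dot z (x + y) = dot z x + dot z y.
Proof. by rewrite dotC dotDl !(dotC z). Qed.

Lemma dotZr (a : R) x y : dot y (a *: x) = a * dot y x.
Proof. by rewrite dotC dotZl dotC. Qed.

Lemma dotNr x y : dot y (- x) = - dot y x.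
Proof. by rewrite dotC dotNl dotC. Qed.

Definition dotE := (dotDl, dotZl, dotNl, dotDr, dotZr, dotNr).

Lemma dotxx_ge0 x : 0 <= dot x x.
Proof. by apply: sumr_ge0 => i _; rewrite -expr2 sqr_ge0. Qed.

Lemma dotxx_eq0 x : dot x x = 0 -> x = 0.
Proof.
move=> /eqP; rewrite psumr_eq0 => [|i _]; last by rewrite -expr2 sqr_ge0.
move=> /allP x0; apply/rowP => i; rewrite mxE; apply/eqP.
by have /(_ (mem_index_enum i)) := x0 i; rewrite mulf_eq0 orbb.
Qed.

Lemma edist_dot S x y : Defs.edist (S x) (S y) = Defs.edist x y ->
  dot (S x - S y) (S x - S y) = dot (x - y) (x - y).
Proof. by move=> /eqP; rewrite eqr_sqrt ?dotxx_ge0 // => /eqP. Qed.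

Lemma isometry_inj S : (forall x y, Defs.edist (S x) (S y) = Defs.edist x y) -> injective S.
Proof.
move=> iso x y Sxy; have := edist_dot (iso x y).
rewrite Sxy subrr -[X in dot X 0](scale0r 0) dotZl mul0r => /esym/dotxx_eq0/eqP.
by rewrite subr_eq0 => /eqP.
Qed.

(** A map that preserves distances preserves scalar products of differences by
    polarization; hence the defect of linearity has zero length. *)
Lemma isometry_affine S c : (forall x y, Defs.edist (S x) (S y) = Defs.edist x y) ->
  exists M, (forall y, S y = S c + (y - c) *m M) /\
    forall y z, dot (y *m M) (z *m M) = dot y z.
Proof.
move=> iso; have [L LE] : exists L, forall y, L y = S (c + y) - S c.
  by exists (fun y => S (c + y) - S c).
have Lxx x y : dot (L x - L y) (L x - L y) = dot (x - y) (x - y).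
  have -> : L x - L y = S (c + x) - S (c + y) by rewrite !LE opprB addrA subrK.
  rewrite (edist_dot (iso _ _)).
  by have -> : c + x - (c + y) = x - y by rewrite opprD addrACA subrr add0r.
have L0 : L 0 = 0 by rewrite LE addr0 subrr.
have Lx x : dot (L x) (L x) = dot x x.
  by have := Lxx x 0; rewrite L0 !subr0.
have Ldot x y : dot (L x) (L y) = dot x y.
  have := Lxx x y; have := Lx x; have := Lx y.
  rewrite !dotE (dotC (L y) (L x)) (dotC y x); lra.
have Llin : linear L.
  move=> a x y; apply/eqP; rewrite -subr_eq0; apply/eqP/dotxx_eq0.
  rewrite !dotE !Ldot !dotE (dotC y x); ring.
pose LM := GRing.isLinear.Build _ _ _ _ _ Llin.
pose LL : {linear 'rV[R]_3 -> 'rV[R]_3} := HB.pack L LM.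
exists (lin1_mx LL); split=> [y|y z]; rewrite !mul_rV_lin1 //=.
by rewrite LE [RHS]addrC subrK addrC subrK.
Qed.

Lemma reflection_isometry S M c t x :
  (forall y, S y = S c + (y - c) *m M) ->
  (forall y z, dot (y *m M) (z *m M) = dot y z) ->
  S (reflection c t x) = reflection (S c) (t *m M) (S x).
Proof.
move=> SM dotM; rewrite /reflection [LHS]SM (SM x) addrAC mulmxBl -scalemxAl.
by rewrite [S c + _ - S c]addrC addKr !dotM addrA.
Qed.

Definition flip x : 'rV[R]_3 := row3 (- x 0 0) (x 0 1) (x 0 2%:R).

Lemma row3_eta x : x = row3 (x 0 0) (x 0 1) (x 0 2%:R).
Proof.
apply/rowP => -[[|[|[|//]]] lt_i3]; rewrite mxE /=;
  by congr (x _ _); apply/val_inj.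
Qed.

Lemma row3E (a b c : R) : ((row3 a b c 0 0 = a) * (row3 a b c 0 1 = b) *
  (row3 a b c 0 2%:R = c))%type.
Proof. by rewrite !mxE. Qed.

Lemma dot_row3 (a b c a' b' c' : R) :
  dot (row3 a b c) (row3 a' b' c') = a * a' + b * b' + c * c'.
Proof. by rewrite /dot !big_ord_recl big_ord0 !mxE /= addr0 !addrA. Qed.

Lemma reflection_first_axis (l : R) t x : l *: t = row3 1 0 0 ->
  reflection 0 t x = flip x.
Proof.
move=> lt; have l0 : l != 0.
  apply/eqP => l0; have /rowP/(_ 0) := lt.
  by rewrite l0 scale0r !mxE /= => /eqP; rewrite eq_sym oner_eq0.
have -> : t = row3 l^-1 0 0.
  rewrite -(scale1r t) -(mulVf l0) -scalerA lt.
  by apply/rowP => -[[|[|[|//]]] lt_i3]; rewrite !mxE /= ?mulr1 ?mulr0.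
rewrite /reflection subr0 {1 2}(row3_eta x) !dot_row3.
apply/rowP => -[[|[|[|//]]] lt_i3]; rewrite !mxE /=; field => //.
Qed.

End isometries.

Section tangent.
Context {R : realType}.
Implicit Types (U N : set 'rV[R]_2) (p : 'rV[R]_2).

Lemma mulmx_differentiable n m (M : 'M[R]_(n, m)) (x : 'rV[R]_n) :
  differentiable (fun y : 'rV[R]_n => y *m M) x.
Proof.
apply: (smooth_differentiable openT) => //; apply/(smooth_rowP _ openT) => j.
have C : smooth setT (fun y : 'rV[R]_n => \sum_i y 0 i * M i j).
  move=> k; apply: class_C_sum => [|i]; first exact: openT.
  apply: class_CM; [exact: openT|exact: smooth_coord|exact: class_C_cst].
by apply: smooth_ext openT _ C => y _; rewrite mxE.
Qed.

Lemma derive_mulmx n m (M : 'M[R]_(n, m)) (x w : 'rV[R]_n) :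
  'D_w (fun y : 'rV[R]_n => y *m M) x = w *m M.
Proof.
rewrite (deriveE _ (mulmx_differentiable M x)).
rewrite -[fun y => _]/(mulmxr M : 'rV[R]_n -> 'rV[R]_m) diff_lin //= => y.
exact/differentiable_continuous/mulmx_differentiable.
Qed.

Lemma derive_plane (W : normedModType R) (g : 'rV[R]_2 -> W) x w :
  differentiable g x -> 'D_w g x = w 0 0 *: 'D_e_u g x + w 0 1 *: 'D_e_v g x.
Proof.
move=> dg; rewrite derive_basis // big_ord_recl big_ord1.
by have -> : lift ord0 ord0 = 1 :> 'I_2 by apply/val_inj.
Qed.

(** In the coordinates that define t, one of the two coordinate directions is in the
    kernel of the differential of f at p. *)
Lemma tangent_span U (f : 'rV[R]_2 -> 'rV[R]_3) p t w :
  differentiable f p -> tangent_vector U f p t -> exists l : R, 'D_w f p = l *: t.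
Proof.
move=> df [N [psi [/local_coordinatesP[[oN N0 psi0 Cpsi] [k [oM Ck _ kpsi psik]]] fv fu]]].
have Mp : (psi @` N) p by exists 0.
have dpsi : differentiable psi 0 by exact: smooth_differentiable Cpsi N0.
have dk : differentiable k p by exact: smooth_differentiable Ck Mp.
have kp : k p = 0 by rewrite -psi0 kpsi.
have df0 : differentiable f (psi 0) by rewrite psi0.
pose w' := 'D_w k p; exists (w' 0 0).
have ww : 'D_w' psi 0 = w.
  have dpsik : differentiable psi (k p) by rewrite kp.
  rewrite /w' -kp -(derive_comp _ dk dpsik) -[RHS](derive_id p).
  by apply: near_eq_derive; exact: near_of_open oM Mp psik.
rewrite -ww -psi0 -derive_comp // (derive_plane _ (differentiable_comp dpsi df0)).
by rewrite fv fu scaler0 addr0.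
Qed.

End tangent.
(** * Characteristic functions and the symmetry *)

Section characteristic.
Context {R : realType}.
Implicit Types (U N : set 'rV[R]_2) (f : 'rV[R]_2 -> 'rV[R]_3).

(** In the normal form the tangent line is the first axis, so the reflection is the
    change of sign of the first coordinate. *)
Lemma characteristic_reflection U f p t (a : 'rV[R]_2 -> R) (b : R -> R) N psi S :
  open U -> smooth U f -> U p -> tangent_vector U f p t ->
  b 0 = 0 -> smooth_near 0 a -> a 0 = 0 -> 'D_e_u a 0 = 0 ->
  local_coordinates U p N psi ->
  (forall x y, Defs.edist (S x) (S y) = Defs.edist x y) ->
  (forall q, N q -> S (f (psi q)) =
     row3 (q 0 0) (q 0 0 * q 0 1 + b (q 0 1)) (a q)) ->
  forall y, S (reflection (f p) t y) = flip (S y).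
Proof.
move=> oU Cf Up tt b0 Ca a0 au /local_coordinatesP[[oN N0 psi0 Cpsi] _] iso SE y.
have Sfp : S (f p) = 0.
  rewrite -psi0 SE // a0 !mxE mul0r add0r b0.
  by apply/rowP => -[[|[|[|//]]] lt_i3]; rewrite !mxE.
have [M [SM dotM]] := isometry_affine (f p) iso.
rewrite (reflection_isometry _ _ SM dotM) Sfp.
have df : differentiable f p by exact: smooth_differentiable Cf Up.
have dpsi : differentiable psi 0 by exact: smooth_differentiable Cpsi N0.
have df0 : differentiable f (psi 0) by rewrite psi0.
have dg := differentiable_comp dpsi df0.
have [l gu] : exists l, 'D_e_u (f \o psi) 0 = l *: t.
  by rewrite derive_comp // psi0; exact: tangent_span df tt.
suff lt : l *: (t *m M) = row3 1 0 0 by exact: reflection_first_axis lt.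
rewrite scalemxAl -gu -(derive_mulmx M ((f \o psi) 0)).
rewrite -derive_comp //; last exact: mulmx_differentiable.
have dh : differentiable ((fun y => y *m M) \o (f \o psi)) 0.
  by apply: differentiable_comp => //; exact: mulmx_differentiable.
have hE q : N q -> ((fun y => y *m M) \o (f \o psi)) q =
    row3 (q 0 0) (q 0 0 * q 0 1 + b (q 0 1)) (a q) + f p *m M.
  by move=> /SE; rewrite SM Sfp add0r mulmxBl => <-; rewrite subrK.
have hj j : 'D_e_u ((fun y => y *m M) \o (f \o psi)) 0 0 j =
    'D_e_u (fun q : 'rV[R]_2 => row3 (q 0 0) (q 0 0 * q 0 1 + b (q 0 1)) (a q) 0 j
      + (f p *m M) 0 j) 0.
  rewrite derive_row; last exact: diff_derivable.
  by apply: near_eq_derive; apply: near_of_open oN N0 _ => q Nq; rewrite hE // mxE.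
have const_der (g : 'rV[R]_2 -> R) (c : R) : derivable g 0 e_u ->
    'D_e_u (fun q => g q + c) 0 = 'D_e_u g 0.
  by move=> dgu; rewrite deriveD // ?derive_cst ?addr0.
apply/rowP => j; rewrite hj.
case: j => -[|[|[|//]]] lt_i3; under eq_fun do rewrite [row3 _ _ _ _ _]mxE /=;
  rewrite [RHS]mxE /=.
- have [du <-] : is_derive (0 : 'rV[R]_2) e_u (fun q : 'rV[R]_2 => q 0 0) (1 : R).
    by have := is_derive_coord 0 (0 : 'rV[R]_2) e_u; rewrite mxE.
  exact: const_der.
- rewrite -(derive_cst ((f p *m M) 0 (Ordinal lt_i3)) 0 e_u).
  apply: derive_on_line; near=> s.
  have -> : (s *: e_u + 0) 0 1 = 0 :> R by rewrite addr0 !mxE mulr0.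
  by rewrite mulr0 b0 !add0r.
- rewrite const_der //; have [A [oA A0 CA]] := Ca.
  exact: smooth_derivable CA A0.
Unshelve. all: by end_near. Qed.

Lemma smooth_opp n : smooth [set: 'rV[R]_n] (fun q : 'rV[R]_n => - q).
Proof.
apply/(smooth_rowP _ openT) => j.
have C : smooth [set: 'rV[R]_n] (fun q : 'rV[R]_n => - 1 * q 0 j).
  apply: smoothM; [exact: openT|move=> k; exact: class_C_cst|exact: smooth_coord].
by apply: smooth_ext openT _ C => q _; rewrite mxE mulN1r.
Qed.

Lemma jacobian_opp : \det ('J (fun q : 'rV[R]_2 => - q) 0) = 1.
Proof.
have -> : 'J (fun q : 'rV[R]_2 => - q) 0 = (- 1)%:M.
  have dN := smooth_differentiable openT (@smooth_opp 2) (I : [set: 'rV[R]_2] 0).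
  apply: jacobian_eq => // w; rewrite mul_mx_scalar scaleN1r.
  by rewrite [LHS]deriveN ?derive_id //; exact: derivable_id.
by rewrite det_scalar sqrrN expr1n.
Qed.

(** In the coordinates of the normal form the symmetry is q |-> - q. *)
Lemma symmetric_has_symmetry U f p t (a : 'rV[R]_2 -> R) (b : R -> R) :
  open U -> smooth U f -> U p -> tangent_vector U f p t ->
  characteristic_functions U f p a b -> symmetric_characteristic_functions a b ->
  has_symmetry U f p (reflection (f p) t).
Proof.
move=> oU Cf Up tt [[_ b0 _ _] [[Ca a0 au _ _] [N [psi [S [lc _ [iso _] SE]]]]]].
move=> [sa sb].
have ST := characteristic_reflection oU Cf Up tt b0 Ca a0 au lc iso SE.
have [[oN N0 _ _] _] := local_coordinatesP lc.
apply: (symmetry_of_chart lc openT I (@smooth_opp 2)); first exact: oppr0.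
- by rewrite jacobian_opp.
- by near=> q; rewrite opprK.
have nN : \forall q \near (0 : 'rV[R]_2), N q by exact: open_nbhs_nbhs.
have nN' : \forall q \near (0 : 'rV[R]_2), N (- q).
  have c := smooth_continuous (@smooth_opp 2) (I : [set: 'rV[R]_2] 0).
  by apply: c; rewrite /= oppr0.
have sb' : \forall q \near (0 : 'rV[R]_2), b ((q : 'rV[R]_2) 0 1) = b (- q 0 1).
  have := @coord_continuous R 1 2 0 1 0 [set v | b v = b (- v)].
  by rewrite mxE; exact.
near=> q; apply: (isometry_inj iso); rewrite ST !SE; [|by near: q|by near: q].
have -> : a (- q) = a q by apply/esym; near: q.
have E : b (q 0 1) = b (- q 0 1) by near: q.
by rewrite /flip !row3E !mxE mulrNN -E.
Unshelve. all: by end_near. Qed.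

Lemma differentiable_norm_le (V W : normedModType R) (g : V -> W) :
  differentiable g 0 -> g 0 = 0 ->
  exists C : R, \forall h \near (0 : V), `|g h| <= C * `|h|.
Proof.
move=> dg g0; have /diff_locallyP[cd /eqaddoP/(_ _ ltr01)] := dg.
have [k k0 dk] := linear_lipschitz cd.
move=> est; exists (1 + k); move: est; apply: filterS => h /=.
rewrite !fctE /= addr0 g0 add0r mul1r => H.
rewrite -[g h](subrK ('d g 0 h)) (le_trans (ler_normD _ _)) // mulrDl mul1r.
exact: lerD.
Qed.

(** Read in the coordinates of the normal form, the symmetry has the form
    (u, v) |-> (-u, V (u, v)), and it preserves the last two components of S \o f.
    The second component gives the equation of symmetry_rigidity, so V (u, v) = -v and
    b is even; the third component then says that a is even. *)
Lemma has_symmetry_symmetric U f p t (a : 'rV[R]_2 -> R) (b : R -> R) :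
  open U -> smooth U f -> U p -> tangent_vector U f p t ->
  characteristic_functions U f p a b ->
  has_symmetry U f p (reflection (f p) t) -> symmetric_characteristic_functions a b.
Proof.
move=> oU Cf Up tt [[Cb b0 b1 b2] [[Ca a0 au _ _] [N [psi [S [lc _ [iso _] SE]]]]]].
move=> [W [phi [[oW _ Wp WU] [[_ _ Cphi _ _] _ phip _ fphi]]]].
have ST := characteristic_reflection oU Cf Up tt b0 Ca a0 au lc iso SE.
have [[oN N0 psi0 Cpsi] [k [oM Ck _ kpsi psik]]] := local_coordinatesP lc.
set M := psi @` N in oM Ck psik.
have Mp : M p by exists 0.
have kp : k p = 0 by rewrite -psi0 kpsi.
have kN x : M x -> N (k x) by move=> [q Nq <-]; rewrite kpsi.
pose W' := W `&` phi @^-1` M.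
have oW' : open W'.
  by apply: open_preimage_in => // x Wx; exact: smooth_continuous Cphi Wx.
pose O := N `&` psi @^-1` W'.
have oO : open O.
  by apply: open_preimage_in => // q Nq; exact: smooth_continuous Cpsi Nq.
have O0 : O 0 by split; rewrite //= psi0; split=> //=; rewrite phip.
pose Q := k \o (phi \o psi).
have CQ : smooth O Q.
  have C1 : smooth O (phi \o psi).
    apply: (smooth_comp oO oW _ (smooth_sub _ Cpsi) Cphi); last by move=> q [].
    by move=> q [_ []].
  by apply: (smooth_comp oO oM _ C1 Ck) => q [_ []].
have Q0 : Q 0 = 0 by rewrite /Q /= psi0 phip.
have QE q : O q -> [/\ Q q 0 0 = - q 0 0,
    b (Q q 0 1) - q 0 0 * Q q 0 1 = q 0 0 * q 0 1 + b (q 0 1) & a (Q q) = a q].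
  move=> [Nq [Wq Mq]]; have := SE _ (kN _ Mq).
  rewrite psik // fphi // ST SE // /flip !row3E -/(phi (psi q)).
  rewrite -[k (phi (psi q))]/(Q q) => /rowP E.
  have := E 0; have := E 1; have := E 2%:R; rewrite !mxE /= => E2 E1 E0.
  by split=> //; rewrite E1 -E0 mulNr addrC.
pose V q := Q q 0 1.
have CV : smooth O V by have /(smooth_rowP _ oO) := CQ; exact.
have nO : nbhs (0 : 'rV[R]_2) O by exact: open_nbhs_nbhs.
have V0 : V 0 = 0 by rewrite /V Q0 mxE.
have [C VC] := differentiable_norm_le (smooth_differentiable_scalar oO CV O0) V0.
have rigid : \forall q \near (0 : 'rV[R]_2), V q = - q 0 1 /\ b (q 0 1) = b (- q 0 1).
  apply: (symmetry_rigidity _ _ VC).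
  - by move=> e; exact: flat_lipschitz.
  - by apply: filterS nO => q Oq; exact: smooth_continuous CV Oq.
  - by apply: filterS nO => q /QE[].
split.
  apply: filterS2 nO rigid => q /QE[Q0q _ aQ] [Vq _].
  by rewrite -aQ; congr a; apply: row2P; rewrite mxE.
move: rigid => /nbhs_norm0P[d /= d0 Hd]; apply/nbhs_norm0P; exists d => // v /= vd.
have [|_] := Hd (row2 0 v); last by rewrite row2_1.
by apply: le_lt_trans vd; apply: row2_norm_le; rewrite ?normr0.
Qed.

End characteristic.
(** * Lifting the symmetry of the image through the standard cross cap *)

Section lifting.
Context {R : realType}.
Notation X := (@standard_cross_cap R).
Notation E i := (delta_mx 0 i : 'rV[R]_3).

Lemma det_mx2 (A : 'M[R]_2) : \det A = A 0 0 * A 1 1 - A 0 1 * A 1 0.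
Proof.
rewrite (expand_det_row _ 0) big_ord_recl big_ord1 /cofactor !det_mx11 !mxE /=.
have -> : lift ord0 ord0 = 1 :> 'I_2 by apply/val_inj.
have -> : lift 1 0 = 0 :> 'I_2 by apply/val_inj.
by rewrite /= expr0 expr1 mul1r mulN1r mulrN.
Qed.

Lemma off_axis_eq (O : set 'rV[R]_2) (g h : 'rV[R]_2 -> R) :
  open O -> class_C 0 O g -> class_C 0 O h ->
  (forall q, O q -> q 0 0 != 0 -> g q = h q) -> forall q, O q -> g q = h q.
Proof.
move=> oO cg ch gh q Oq; have [q0|q0] := eqVneq (q 0 0) 0; last exact: gh.
apply/eqP; rewrite -subr_eq0; apply/eqP; apply: contrapT => /eqP d0.
have cd : {for q, continuous (fun q => g q - h q)}.
  apply: (@continuousB _ _ _ g h q); [exact: (cg q Oq)|exact: (ch q Oq)].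
have nd : \forall y \near q, g y - h y != 0.
  have := cd [set x | x != 0]; apply.
  by apply: open_nbhs_nbhs; split; [exact: open_neq|].
have : nbhs q (O `&` [set y | g y - h y != 0]).
  by apply: filterI => //; exact: open_nbhs_nbhs.
move=> /nbhs_ballP[d /= dgt0 Hd].
have [|Oy] := Hd (q + (d / 2) *: e_u).
  rewrite -ball_normE /ball_ /= opprD addrA subrr add0r normrN normrZ.
  rewrite gtr0_norm ?divr_gt0 // (_ : `|e_u| = 1); last first.
    apply/le_anti/andP; split.
      by apply: row_norm_le => // i; rewrite /e_u mxE; case: (_ && _); rewrite ?normr0 ?normr1.
    by have := row_coord_le (e_u : 'rV[R]_2) 0; rewrite {1}/e_u mxE normr1.
  lra.
rewrite /= gh ?subrr ?eqxx // !mxE q0 /= add0r mulr1.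
by rewrite mulf_neq0 ?gt_eqF // invr_gt0.
Qed.

Lemma standard0 : X 0 = 0.
Proof.
by apply/rowP => -[[|[|[|//]]] lt_i3]; rewrite !mxE /= ?mul0r ?expr0n.
Qed.

Lemma standard_smooth : smooth setT X.
Proof.
have C i : smooth [set: 'rV[R]_2] (fun q : 'rV[R]_2 => q 0 i) by exact: smooth_coord.
apply/(smooth_rowP _ openT) => -[[|[|[|//]]] lt_i3].
- by apply: smooth_ext openT _ (C 0) => q _; rewrite mxE.
- by apply: smooth_ext openT _ (smoothM openT (C 0) (C 1)) => q _; rewrite mxE.
- by apply: smooth_ext openT _ (smoothM openT (C 1) (C 1)) => q _; rewrite mxE /= expr2.
Qed.

Lemma standard_derive (q w : 'rV[R]_2) :
  'D_w X q = row3 (w 0 0) (w 0 0 * q 0 1 + q 0 0 * w 0 1) (2 * q 0 1 * w 0 1).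
Proof.
have dX : derivable X q w by exact: smooth_derivable standard_smooth _.
have d i := is_derive_coord i q w.
apply/rowP => j; rewrite derive_row //; case: j => -[|[|[|//]]] lt_i3;
  under eq_fun do rewrite mxE /=; rewrite mxE /=.
- by have [] := d 0.
- have [d0 E0] := d 0; have [d1 E1] := d 1.
  by rewrite deriveM // E0 E1 addrC mulrC.
- have [d1 E1] := d 1; under eq_fun do rewrite expr2.
  rewrite deriveM // E1 /GRing.scale /=; ring.
Qed.

(** The image of the standard cross cap lies in the zero set of this polynomial, the
    Whitney umbrella. *)
Definition umbrella (y : 'rV[R]_3) : R := y 0 1 * y 0 1 - y 0 0 * y 0 0 * y 0 2%:R.

Lemma umbrella_standard q : umbrella (X q) = 0.
Proof. by rewrite /umbrella !mxE /=; ring. Qed.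

Lemma umbrella_smooth (A : set 'rV[R]_3) : open A -> smooth A umbrella.
Proof.
move=> oA; have C i : smooth A (fun y : 'rV[R]_3 => y 0 i) by exact: smooth_coord.
have C1 : smooth A (fun y : 'rV[R]_3 => -1 * (y 0 0 * y 0 0 * y 0 2%:R)).
  apply: smoothM => //; first by move=> n; exact: class_C_cst.
  by apply: smoothM => //; apply: smoothM.
have C2 : smooth A (fun y : 'rV[R]_3 => y 0 1 * y 0 1) by exact: smoothM.
by move=> n; apply: class_C_ext (class_CD oA (C2 n) (C1 n)) => // y _; rewrite mulN1r.
Qed.

Lemma umbrella_derive (y : 'rV[R]_3) : 'D_(E 2%:R) umbrella y = - (y 0 0 * y 0 0).
Proof.
have [dc Dc] := is_derive_coord 2%:R y (E 2%:R).
pose k := - (y 0 0 * y 0 0).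
rewrite (@derive_on_line _ _ _ umbrella (k *: (fun z : 'rV[R]_3 => z 0 2%:R)
    + cst (y 0 1 * y 0 1))).
  rewrite deriveD; [|exact: derivableZ|exact: derivable_cst].
  by rewrite derive_cst addr0 deriveZ // Dc mxE /GRing.scale /= mulr1.
near=> s; rewrite /umbrella !fctE /k !mxE /= /GRing.scale /= !mulr0 !add0r; ring.
Unshelve. all: by end_near. Qed.

End lifting.
Section lift.
Context {R : realType}.
Notation X := (@standard_cross_cap R).
Notation E i := (delta_mx 0 i : 'rV[R]_3).
Variables (O : set 'rV[R]_3) (G : 'rV[R]_3 -> 'rV[R]_3).
Hypotheses (oO : open O) (O0 : O 0) (CG : smooth O G) (G0 : G 0 = 0).
Hypotheses (GO : forall y, O y -> O (G y)) (GK : forall y, O y -> G (G y) = y).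

(** At the double point X (0, v) = X (0, -v) with v <> 0, the two tangent planes
    of the cross cap span the whole space. So the differential of umbrella \o G
    vanishes there, and umbrella is singular at the image by G of the double point;
    the singular points of umbrella lie in the plane of equation y0 = 0. *)
Lemma double_curve_invariant (r : R) :
  (forall q, ball (0 : 'rV[R]_2) r q -> O (X q) /\ umbrella (G (X q)) = 0) ->
  forall q, ball (0 : 'rV[R]_2) r q -> q 0 0 = 0 -> G (X q) 0 0 = 0.
Proof.
move=> HX q Bq q0; have [q1|q1] := eqVneq (q 0 1) 0.
  have -> : q = 0 by apply: row2P; rewrite ?q0 ?q1 mxE.
  by rewrite standard0 G0 mxE.
pose q' := row2 0 (- q 0 1).
have Bq' : ball (0 : 'rV[R]_2) r q'.
  move: Bq; rewrite !ball0E; apply: le_lt_trans; apply: row2_norm_le.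
    by rewrite normr0.
  by rewrite normrN row_coord_le.
have XX : X q' = X q.
  by rewrite /X /q' row2_0 row2_1 q0 !mul0r sqrrN.
have [OX _] := HX q Bq.
pose P := umbrella \o G.
have dP : differentiable P (X q).
  apply: differentiable_comp; first exact: smooth_differentiable CG OX.
  exact: (smooth_differentiable_scalar openT (umbrella_smooth openT) I).
have dX x : differentiable X x by exact: (smooth_differentiable openT standard_smooth I).
have kill x w : ball (0 : 'rV[R]_2) r x -> X x = X q -> 'd P (X q) ('D_w X x) = 0.
  move=> Bx Xx; have dPx : differentiable P (X x) by rewrite Xx.
  rewrite -(deriveE _ dP) -Xx -(derive_comp _ (dX x) dPx).
  rewrite -(derive_cst 0 x w); apply: near_eq_derive.
  apply: (near_of_open (@ball_open _ _ 0 r) Bx) => y By.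
  by have [_ <-] := HX y By.
have dP0 w : 'd P (X q) w = 0.
  (* w is decomposed in the basis made of X_u at q, X_u at q' and X_v at q. *)
  have k1 := kill q e_u Bq erefl; have k2 := kill q' e_u Bq' XX.
  have k3 := kill q e_v Bq erefl.
  rewrite !standard_derive in k1 k2 k3.
  have -> : w = ((w 0 0 + w 0 1 / q 0 1) / 2) *:
      row3 (e_u 0 0) (e_u 0 0 * q 0 1 + q 0 0 * e_u 0 1) (2 * q 0 1 * e_u 0 1) +
      (((w 0 0 - w 0 1 / q 0 1) / 2) *:
      row3 (e_u 0 0) (e_u 0 0 * q' 0 1 + q' 0 0 * e_u 0 1) (2 * q' 0 1 * e_u 0 1) +
      (w 0 2%:R / (2 * q 0 1)) *:
      row3 (e_v 0 0) (e_v 0 0 * q 0 1 + q 0 0 * e_v 0 1) (2 * q 0 1 * e_v 0 1)).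
    rewrite {1}(row3_eta w) /q' row2_0 row2_1 q0 /e_u /e_v.
    by apply/rowP => -[[|[|[|//]]] lt_i3]; rewrite !mxE /=; field.
  by rewrite !linearD !linearZ /= k1 k2 k3 !scaler0 !addr0.
have OG := GO OX.
have dG : differentiable G (G (X q)) by exact: smooth_differentiable CG OG.
have dPG : differentiable P (G (G (X q))) by rewrite GK.
have := umbrella_derive (G (X q)).
have -> : 'D_(E 2%:R) umbrella (G (X q)) = 'D_(E 2%:R) (P \o G) (G (X q)).
  by apply: near_eq_derive; apply: (near_of_open oO OG) => y Oy; rewrite /P /= GK.
rewrite derive_comp // GK // deriveE // dP0 => /esym/eqP.
by rewrite oppr_eq0 mulf_eq0 orbb => /eqP.
Qed.

Hypothesis DG0 : 'D_(E 0) G 0 = - E 0.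
Hypothesis DG : forall w, exists l : R, 'D_w G 0 = w + l *: E 0.
Hypothesis image : \forall q \near (0 : 'rV[R]_2), umbrella (G (X q)) = 0.

(** Write H = G \o X. By Hadamard's lemma H0 = u alpha and H1 = u beta, and the lift
    eta is (u alpha, beta / alpha): the first two components of X \o eta = H hold by
    construction, and the third one holds off the axis u = 0, because H takes its values
    in the zero set of umbrella. Continuity extends it to the axis. The lift is an
    involution because G is one and X is injective off the axis. *)
Lemma lift_involution : exists (A : set 'rV[R]_2) (eta : 'rV[R]_2 -> 'rV[R]_2),
  [/\ open A, A 0, smooth A eta & eta 0 = 0] /\
  [/\ 0 < \det ('J eta 0), \forall q \near (0 : 'rV[R]_2), eta (eta q) = q &
      \forall q \near (0 : 'rV[R]_2), X (eta q) = G (X q)].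
Proof.
have X0 : X 0 = 0 := standard0.
have X1 q : X q 0 1 = q 0 0 * q 0 1 by rewrite mxE.
have cX q : {for q, continuous X} by exact: (smooth_continuous standard_smooth I).
have dX x : differentiable X x by exact: (smooth_differentiable openT standard_smooth I).
have [r r0 HX] : exists2 r : R, 0 < r & forall q, ball (0 : 'rV[R]_2) r q ->
    O (X q) /\ umbrella (G (X q)) = 0.
  have nX : nbhs (0 : 'rV[R]_2) (X @^-1` O).
    by apply: (cX 0); rewrite X0; exact: open_nbhs_nbhs.
  have : nbhs (0 : 'rV[R]_2) ((X @^-1` O) `&` [set q | umbrella (G (X q)) = 0]).
    exact: filterI.
  by move=> /nbhs_ballP[r /= r0 Hr]; exists r => // q /Hr[].
set B := ball (0 : 'rV[R]_2) r in HX.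
have oB : open B by exact: ball_open.
have B0 : B 0 by exact: ballxx.
pose H := G \o X.
have CH : smooth B H.
  apply: (smooth_comp oB oO _ (smooth_sub _ standard_smooth) CG) => // q Bq.
  by have [] := HX q Bq.
have H00 q : B q -> q 0 0 = 0 -> H q 0 0 = 0 by exact: double_curve_invariant HX q.
have H10 q : B q -> q 0 0 = 0 -> H q 0 1 = 0.
  move=> Bq q0; have [_] := HX q Bq.
  rewrite /umbrella -/(H q) [X in X * _ * _](H00 q Bq q0) !mul0r subr0 => /eqP.
  by rewrite mulf_eq0 orbb => /eqP.
have CHi i : smooth B (fun q => H q 0 i) by have /(smooth_rowP _ oB) := CH; exact.
have [alpha [Ca Ha]] := hadamard (CHi 0) H00.
have [beta [Cb Hb]] := hadamard (CHi 1) H10.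
have DH q w : B q -> 'D_w H q = 'D_('D_w X q) G (X q).
  move=> Bq; rewrite derive_comp //; apply: smooth_differentiable oO CG _.
  by have [] := HX q Bq.
have coord_der (g h : 'rV[R]_2 -> R) q : B q -> smooth B h ->
    (forall q, B q -> g q = q 0 0 * h q) -> q 0 0 = 0 ->
    'D_e_u g q = h q /\ 'D_e_v g q = 0.
  move=> Bq Ch gh q0.
  have D w : 'D_w g q = w 0 0 * h q.
    rewrite (near_eq_derive w (near_of_open oB Bq gh)).
    have [d0 E0] := is_derive_coord 0 q w.
    have dh : derivable h q w by exact: smooth_derivable Ch Bq.
    rewrite (deriveM d0 dh).
    by rewrite E0 q0 scale0r add0r mulrC.
  by rewrite !D /e_u /e_v !mxE mul1r mul0r.
have dHq q w : B q -> derivable H q w by move=> Bq; exact: smooth_derivable CH Bq.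
have DX0u : 'D_e_u X 0 = E 0.
  rewrite standard_derive; apply/rowP => -[[|[|[|//]]] lt_i3];
    by rewrite !mxE /= ?(mulr0, mul0r, addr0).
have DX0v : 'D_e_v X 0 = 0.
  rewrite standard_derive; apply/rowP => -[[|[|[|//]]] lt_i3];
    by rewrite !mxE /= ?(mulr0, mul0r, addr0).
have c00 : (0 : 'rV[R]_2) 0 0 = 0 by rewrite mxE.
have [a_u _] := coord_der _ _ 0 B0 Ca Ha c00.
have alpha0 : alpha 0 = -1.
  by rewrite -a_u -derive_row ?DH ?DX0u ?X0 ?DG0 ?mxE //; exact: dHq.
have [A [oA A0 AB anz]] : exists A : set 'rV[R]_2, [/\ open A, A 0, A `<=` B &
    forall q, A q -> alpha q != 0].
  exists (B `&` alpha @^-1` [set x | x != 0]); split=> //; last by move=> q [].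
  - by apply: open_preimage_in oB (@open_neq _ 0) _ => q Bq; exact: smooth_continuous Ca Bq.
  - by split=> //=; rewrite alpha0 oppr_eq0 oner_eq0.
pose eta (q : 'rV[R]_2) := row2 (q 0 0 * alpha q) (beta q * (alpha q)^-1).
have CA (g : 'rV[R]_2 -> R) : smooth B g -> smooth A g by exact: smooth_sub.
have Ceta : smooth A eta.
  apply/(smooth_rowP _ oA) => -[[|[|//]] lt_i2].
    have C := smoothM oA (@smooth_coord R _ A 0) (CA _ Ca).
    by apply: smooth_ext oA _ C => q _; rewrite mxE.
  have C := smoothM oA (CA _ Cb) (smoothV oA anz (CA _ Ca)).
  by apply: smooth_ext oA _ C => q _; rewrite mxE.
have [b_u _] := coord_der _ _ 0 B0 Cb Hb c00.
have beta0 : beta 0 = 0.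
  by rewrite -b_u -derive_row ?DH ?DX0u ?X0 ?DG0 ?mxE ?oppr0 //; exact: dHq.
have eta0 : eta 0 = 0.
  by apply: row2P; rewrite /eta ?row2_0 ?row2_1 ?beta0 !mxE mul0r.
(* On the axis u = 0, where 'D_e_u X = E 0 + v E 1, Hadamard's quotient beta is the
   component along E 1 of 'D_(E 0) G + v 'D_(E 1) G. The first term is a function of
   v ^+ 2 and does not contribute; the second one contributes 'D_(E 1) G 0 0 1 = 1. *)
have d_beta : 'D_e_v beta 0 = 1.
  pose rho i (y : 'rV[R]_3) := ('D_(E i) G) y 0 1.
  have Crho i : smooth O (rho i).
    by have /(smooth_rowP _ oO) := smooth_derive (E i) CG; exact.
  have OX0 : O (X 0) by rewrite X0.
  have drho i : differentiable (rho i) (X 0).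
    exact: smooth_differentiable_scalar oO (Crho i) OX0.
  have drhoX i : derivable (rho i \o X) 0 e_v.
    by apply/diff_derivable/differentiable_comp.
  have DrhoX i : 'D_e_v (rho i \o X) 0 = 0.
    by rewrite derive_comp // DX0v derive0.
  have [d1 E1] := is_derive_coord 1 (0 : 'rV[R]_2) e_v.
  have -> : 'D_e_v beta 0 = 'D_e_v ((rho 0 \o X) +
      (fun q : 'rV[R]_2 => q 0 1) * (rho 1 \o X)) 0.
    apply: derive_on_line.
    have nB : \forall s \near (0 : R), B (s *: e_v + 0).
      apply/nbhs_norm0P; exists r => //= s sr; apply/ball0E; rewrite addr0.
      apply: le_lt_trans sr; apply: row_norm_le => // j; rewrite !mxE normrM.
      by rewrite ler_piMr //; case: (_ && _); rewrite ?normr0 ?normr1.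
    apply: filterS nB => s; set q := _ + _ => Bq.
    have q0 : q 0 0 = 0 by rewrite /q addr0 !mxE mulr0.
    have [<- _] := coord_der _ _ q Bq Cb Hb q0.
    rewrite -derive_row ?DH //; last exact: dHq.
    have OXq : O (X q) by have [] := HX q Bq.
    have dGq : differentiable G (X q) by exact: smooth_differentiable CG OXq.
    have -> : 'D_e_u X q = E 0 + q 0 1 *: E 1.
      rewrite standard_derive q0; apply/rowP => -[[|[|[|//]]] lt_i3];
        by rewrite !mxE /= ?(mulr0, mulr1, mul1r, mul0r, addr0, add0r).
    rewrite (deriveE _ dGq) linearD linearZ -!(deriveE _ dGq) /=.
    by rewrite [LHS]mxE; congr (_ + _); rewrite [LHS]mxE.
  rewrite (deriveD (drhoX 0) (derivableM d1 (drhoX 1))).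
  rewrite DrhoX add0r (deriveM d1 (drhoX 1)) DrhoX E1 scaler0 add0r /= X0 /rho.
  have [l ->] := DG (E 1).
  by rewrite !mxE /= mulr0 addr0 /GRing.scale /= mulr1.
have deta : differentiable eta 0 by exact: smooth_differentiable Ceta A0.
have Jeta i j : 'J eta 0 i j = 'D_(delta_mx 0 i) (fun q => eta q 0 j) 0.
  by rewrite jacobianE // derive_row //; exact: diff_derivable.
have eta_0 q : eta q 0 0 = q 0 0 * alpha q by rewrite row2_0.
have [J00 J10] := coord_der (fun q => eta q 0 0) alpha 0 B0 Ca (fun q _ => eta_0 q) c00.
have J11 : 'D_e_v (fun q => eta q 0 1) 0 = -1.
  have -> : (fun q => eta q 0 1) = beta * (fun q => (alpha q)^-1).
    by apply/funext => q; rewrite row2_1.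
  have db : derivable beta 0 e_v by exact: smooth_derivable Cb B0.
  have da : derivable (fun q => (alpha q)^-1) 0 e_v.
    exact: smooth_derivable (smoothV oA anz (CA _ Ca)) A0.
  by rewrite (deriveM db da) d_beta beta0 scale0r add0r alpha0 invrN1 /GRing.scale /= mulr1.
(* The Jacobian matrix is triangular and both of its diagonal entries are -1. *)
have detJ : \det ('J eta 0) = 1.
  rewrite det_mx2 !Jeta -/e_u -/e_v J00 J10 J11 alpha0; ring.
have Xeta q : A q -> X (eta q) = H q.
  have CXe i : class_C 0 A (fun q => X (eta q) 0 i).
    have C := smooth_comp oA openT (fun _ _ => I) Ceta standard_smooth.
    by have /(smooth_rowP _ oA) := C; move/(_ i 0%N).
  have CHA i : class_C 0 A (fun q => H q 0 i) by exact: (CA _ (CHi i) 0%N).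
  have E0 q' : A q' -> X (eta q') 0 0 = H q' 0 0.
    by move=> /AB Bq; rewrite Ha // mxE /= eta_0.
  have E1 q' : A q' -> X (eta q') 0 1 = H q' 0 1.
    move=> Aq; rewrite Hb; last exact: AB.
    by rewrite mxE /= row2_1 eta_0; field; exact: anz.
  have E2 : forall q', A q' -> X (eta q') 0 2%:R = H q' 0 2%:R.
    apply: (off_axis_eq oA (CXe _) (CHA _)) => q' Aq q0.
    have := umbrella_standard (eta q'); have [_] := HX q' (AB _ Aq).
    rewrite /umbrella -/(H q') [in X in _ -> X -> _]E0 // [in X in _ -> X -> _]E1 //.
    move=> <- /eqP; rewrite (inj_eq (addrI _)) eqr_opp.
    have nz : H q' 0 0 * H q' 0 0 != 0 by rewrite Ha ?mulf_neq0 ?anz //; exact: AB.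
    by move=> /eqP/(mulfI nz).
  by move=> Aq; rewrite (row3_eta (X _)) (row3_eta (H q)) E0 ?E1 ?E2.
have nA : nbhs (0 : 'rV[R]_2) A by exact: open_nbhs_nbhs.
exists A, eta; split; first by split.
split; first by rewrite detJ.
- pose A2 := A `&` eta @^-1` A.
  have oA2 : open A2.
    by apply: (open_preimage_in oA oA _) => q Aq; exact: smooth_continuous Ceta Aq.
  have A20 : A2 0 by split; rewrite /= ?eta0.
  have Cee : smooth A2 (eta \o eta).
    by apply: (smooth_comp oA2 oA _ (smooth_sub _ Ceta) Ceta) => q [].
  have XX q : A2 q -> X (eta (eta q)) = X q.
    move=> [Aq Aeq]; rewrite Xeta // /H /= Xeta // /H /= GK //.
    by have [] := HX q (AB _ Aq).
  have ee0 q : A2 q -> eta (eta q) 0 0 = q 0 0.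
    by move=> /XX/(congr1 (fun x : 'rV[R]_3 => x 0 0)); rewrite !mxE.
  have ee1 : forall q, A2 q -> (eta \o eta) q 0 1 = q 0 1.
    have C1 : smooth A2 (fun q => (eta \o eta) q 0 1).
      by have /(smooth_rowP _ oA2) := Cee; exact.
    apply: (off_axis_eq oA2 (C1 0%N) (@smooth_coord R _ A2 1 0%N)) => q A2q q0.
    have /(congr1 (fun x : 'rV[R]_3 => x 0 1)) := XX q A2q.
    by rewrite !X1 ee0 // => /(mulfI q0).
  apply: (near_of_open oA2 A20) => q A2q.
  by apply: row2P; [exact: ee0|exact: ee1].
- by apply: filterS nA => q /Xeta.
Qed.

End lift.
(** * Invariance of the image germ *)

Section image.
Context {R : realType}.
Notation X := (@standard_cross_cap R).
Implicit Types (U N : set 'rV[R]_2) (f : 'rV[R]_2 -> 'rV[R]_3) (p : 'rV[R]_2).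

(** Since phi fixes p, it maps the points close to p into the given neighborhood. *)
Lemma has_symmetry_image U f p T : has_symmetry U f p T -> image_germ_invariant U f p T.
Proof.
move=> [W [phi [[oW _ Wp WU] [[_ _ Cphi _ _] _ phip _ fphi]]]] U' nU' U'U.
exists (U' `&` (W `&` phi @^-1` U')); split; last 2 first.
- by move=> x [].
- by move=> _ [_ [x [_ [Wx U'x]] <-] <-]; exists (phi x) => //; exact: fphi.
apply: filterI => //; apply: filterI; first exact: open_nbhs_nbhs.
by apply: (smooth_continuous Cphi Wp); rewrite phip.
Qed.

Lemma reflection_smooth (c t : 'rV[R]_3) : smooth setT (reflection c t).
Proof.
apply/(smooth_rowP _ openT) => j.
pose lin (x : 'rV[R]_3) := \sum_i (x 0 i + - c 0 i) * t 0 i.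
have Clin : smooth setT lin.
  move=> k; apply: class_C_sum => [|i]; first exact: openT.
  apply: class_CM; [exact: openT| |exact: class_C_cst].
  by apply: class_CD; [exact: openT|exact: smooth_coord|exact: class_C_cst].
have C : smooth setT (fun x : 'rV[R]_3 =>
    x 0 j + lin x * (- (2 / dot t t) * t 0 j)).
  move=> k; apply: class_CD; [exact: openT|exact: smooth_coord|].
  by apply: class_CM; [exact: openT|exact: Clin|exact: class_C_cst].
apply: smooth_ext openT _ C => x _; rewrite !mxE.
have -> : lin x = dot (x - c) t by apply: eq_bigr => i _; rewrite !mxE.
by congr (_ + _); ring.
Qed.

Lemma reflection_derive (c t x w : 'rV[R]_3) :
  'D_w (reflection c t) x = w - (2 * (dot w t / dot t t)) *: t.
Proof.
have dr : derivable (reflection c t) x w.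
  exact: smooth_derivable (reflection_smooth c t) I.
have E (s : R) : s^-1 *: (reflection c t (s *: w + x) - reflection c t x) =
    (s^-1 * s) *: (w - (2 * (dot w t / dot t t)) *: t).
  have D : dot (s *: w + x - c) t = s * dot w t + dot (x - c) t.
    by rewrite -addrA (dotDl (s *: w)) dotZl.
  rewrite -scalerA /reflection D; congr (_ *: _).
  by apply/rowP => i; rewrite !mxE; ring.
rewrite /derive; apply: cvg_lim => //=.
have -> : (fun h => h^-1 *: (reflection c t (h *: w + x) - reflection c t x)) =
    (fun s : R => (s^-1 * s) *: (w - (2 * (dot w t / dot t t)) *: t)).
  by apply/funext.
apply: cvg_near_cst; near=> s; rewrite mulVf ?scale1r //.
by near: s; exact: nbhs_dnbhs_neq.
Unshelve. all: by end_near. Qed.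

Lemma reflection_fix (c t : 'rV[R]_3) : reflection c t c = c.
Proof.
by rewrite /reflection subrr -[0](scale0r c) dotZl !mul0r mulr0 scale0r subr0.
Qed.

Lemma reflectionK (c t x : 'rV[R]_3) : t != 0 ->
  reflection c t (reflection c t x) = x.
Proof.
move=> t0; have tt : dot t t != 0 by apply: contra_neq t0; exact: dotxx_eq0.
rewrite /reflection; set m := 2 * (dot (x - c) t / dot t t).
have -> : dot (x - m *: t - c) t = - dot (x - c) t.
  rewrite addrAC (dotDl (x - c)) dotNl (dotZl m) /m; field; exact: tt.
have -> : 2 * (- dot (x - c) t / dot t t) = - m by rewrite /m mulNr mulrN.
by rewrite scaleNr opprK subrK.
Qed.

(** Coordinates of the source and of the target in which f is the standard cross
    cap; the source coordinates are given by their inverse psi. *)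
Lemma cross_cap_chart U f p : cross_cap U f p ->
  exists (N : set 'rV[R]_2) (psi : 'rV[R]_2 -> 'rV[R]_2) (M M0 : set 'rV[R]_3)
    (Phi Psi : 'rV[R]_3 -> 'rV[R]_3),
  [/\ local_coordinates U p N psi, open M, open M0, smooth M Phi & smooth M0 Psi] /\
  [/\ forall x, M x -> M0 (Phi x) /\ Psi (Phi x) = x,
      forall y, M0 y -> M (Psi y) /\ Phi (Psi y) = y,
      forall q, N q -> M (f (psi q)) &
      forall q, N q -> Phi (f (psi q)) = X q].
Proof.
move=> [N [N0 [M [M0 [phi [Phi [[NU Np Mfp NM] [dphi phip dPhi Phifp fE]]]]]]]].
have [oN oN0 Cphi [fun_phi inj_phi surj_phi] [k [Ck kphi]]] := dphi.
have [oM oM0 CPhi [fun_Phi _ surj_Phi] [Psi [CPsi PsiPhi]]] := dPhi.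
have kN q : N0 q -> N (k q) /\ phi (k q) = q.
  by move=> /surj_phi[x Nx <-]; rewrite kphi.
have kim : k @` N0 = N.
  apply/seteqP; split=> [_ [q Nq <-]|x Nx]; first by have [] := kN q Nq.
  by exists (phi x); [exact: fun_phi|exact: kphi].
exists N0, k, M, M0, Phi, Psi; split.
  split=> //; rewrite /local_coordinates kim; split=> //.
  - by rewrite -phip; exact: fun_phi.
  - by rewrite -phip kphi.
  - split=> //; last by exists phi; split=> // q /kN[].
    split.
    + by move=> q /kN[].
    + move=> q q'; rewrite !inE => /kN[_ E1] /kN[_ E2] /(congr1 phi).
      by rewrite E1 E2.
    + by rewrite /set_surj kim.
split.
- by move=> x Mx; split; [exact: fun_Phi|exact: PsiPhi].
- by move=> y /surj_Phi[x Mx <-]; rewrite PsiPhi.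
- by move=> q /kN[/NM].
- by move=> q /kN[Nkq E]; rewrite fE // E.
Qed.

(** In the target coordinates the reflection becomes an involution G. The first
    axis is the image of the tangent line, which the reflection reverses, and the
    reflection acts trivially modulo the tangent line: this is the information
    on the differential of G at the origin that the lifting needs. *)
Lemma image_has_symmetry U f p t :
  open U -> smooth U f -> U p -> cross_cap U f p -> tangent_vector U f p t ->
  image_germ_invariant U f p (reflection (f p) t) ->
  has_symmetry U f p (reflection (f p) t).
Proof.
move=> oU Cf Up cc tt inv.
have [N [psi [M [M0 [Phi [Psi [[lc oM oM0 CPhi CPsi] [PhiM PsiM fM fX]]]]]]]] :=
  cross_cap_chart cc.
have [[oN N0 psi0 Cpsi] [k [oPN Ck NU kpsi psik]]] := local_coordinatesP lc.
set T2 := reflection (f p) t in inv *.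
have CT2 : smooth setT T2 by exact: reflection_smooth.
have T2p : T2 (f p) = f p by exact: reflection_fix.
have X0 : X 0 = 0 := standard0.
have Phip : Phi (f p) = 0 by rewrite -psi0 fX.
have Mp : M (f p) by rewrite -psi0; exact: fM.
have M00 : M0 0 by rewrite -Phip; have [] := PhiM _ Mp.
have Psi0 : Psi 0 = f p by rewrite -Phip; have [] := PhiM _ Mp.
have dPsi : differentiable Psi 0 by exact: smooth_differentiable CPsi M00.
have dPhi : differentiable Phi (f p) by exact: smooth_differentiable CPhi Mp.
have dT2 x : differentiable T2 x by exact: (smooth_differentiable openT CT2 I).
have DPhiPsi w : 'D_('D_w Psi 0) Phi (f p) = w.
  have dPhi' : differentiable Phi (Psi 0) by rewrite Psi0.
  rewrite -Psi0 -(derive_comp w dPsi dPhi') -[RHS](derive_id (0 : 'rV[R]_3)).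
  apply: near_eq_derive; apply: (near_of_open oM0 M00) => y /PsiM[_].
  exact.
have [l lt] : exists l, 'D_(delta_mx 0 0) Psi 0 = l *: t.
  have df : differentiable f p by exact: smooth_differentiable Cf Up.
  have dpsi : differentiable psi 0 by exact: smooth_differentiable Cpsi N0.
  have df0 : differentiable f (psi 0) by rewrite psi0.
  have [l E] := tangent_span ('D_e_u psi 0) df tt; exists l; rewrite -E -psi0.
  rewrite -(derive_comp _ dpsi df0).
  have -> : 'D_e_u (f \o psi) 0 = 'D_e_u (Psi \o X) 0.
    apply: near_eq_derive; apply: (near_of_open oN N0) => q Nq /=.
    by rewrite -fX //; have [_ ->] := PhiM _ (fM q Nq).
  have dX0 : differentiable X 0 by exact: (smooth_differentiable openT standard_smooth I).
  have dPsiX : differentiable Psi (X 0) by rewrite X0.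
  rewrite (derive_comp e_u dX0 dPsiX) X0.
  congr (derive _ _ _); rewrite standard_derive; apply/rowP => -[[|[|[|//]]] lt_i3];
    by rewrite !mxE /= ?(mulr0, mul0r, addr0).
have lDt : l *: 'D_t Phi (f p) = delta_mx 0 0.
  by rewrite -[RHS]DPhiPsi lt (deriveE t dPhi) (deriveE (l *: t) dPhi) linearZ.
have e0_neq0 : delta_mx 0 0 != 0 :> 'rV[R]_3.
  by apply/eqP => /rowP/(_ 0); rewrite !mxE /= => /eqP; rewrite oner_eq0.
have l0 : l != 0.
  by apply: contra_neq e0_neq0 => l0; rewrite -lDt l0 scale0r.
have t0 : t != 0.
  by apply: contra_neq e0_neq0 => t0; rewrite -lDt t0 derive0 scaler0.
have DtPhi : 'D_t Phi (f p) = l^-1 *: delta_mx 0 0.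
  by rewrite -lDt scalerA mulVf // scale1r.
have T2K x : T2 (T2 x) = x by exact: reflectionK.
pose O := M0 `&` (T2 \o Psi) @^-1` M.
pose G := Phi \o (T2 \o Psi).
have CTP : smooth M0 (T2 \o Psi).
  exact: (smooth_comp oM0 openT (fun _ _ => I) CPsi CT2).
have oO : open O.
  by apply: (open_preimage_in oM0 oM) => y My; exact: smooth_continuous CTP My.
have O0 : O 0 by split; rewrite //= Psi0 T2p.
have OM0 : O `<=` M0 by move=> y [].
have CG : smooth O G.
  by apply: (smooth_comp oO oM _ (smooth_sub OM0 CTP) CPhi) => y [].
have G0 : G 0 = 0 by rewrite /G /= Psi0 T2p.
have PsiG y : O y -> Psi (G y) = T2 (Psi y).
  by move=> [_ MT]; have [_ ->] := PhiM _ MT.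
have GO y : O y -> O (G y).
  move=> Oy; have [My MT] := Oy; split; first by have [] := PhiM _ MT.
  by rewrite /= PsiG // T2K; have [] := PsiM y My.
have GK y : O y -> G (G y) = y.
  move=> Oy; rewrite {1}/G /= PsiG // T2K.
  by have [My _] := Oy; have [] := PsiM y My.
have DGE w : 'D_w G 0 = w - (2 * (dot ('D_w Psi 0) t / dot t t)) *: 'D_t Phi (f p).
  have dT2' : differentiable T2 (Psi 0) by [].
  have dTP := differentiable_comp dPsi dT2'.
  have dPhi' : differentiable Phi ((T2 \o Psi) 0) by rewrite /= Psi0 T2p.
  rewrite (derive_comp w dTP dPhi') (derive_comp w dPsi dT2') reflection_derive /=.
  rewrite Psi0 T2p; rewrite (deriveE _ dPhi) linearB linearZ /= -!(deriveE _ dPhi).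
  by rewrite DPhiPsi.
have tt0 : dot t t != 0 by apply: contra_neq t0; exact: dotxx_eq0.
have DG0 : 'D_(delta_mx 0 0) G 0 = - delta_mx 0 0.
  rewrite DGE lt dotZl DtPhi scalerA.
  have -> : 2 * (l * dot t t / dot t t) * l^-1 = 2 by field; rewrite l0.
  by rewrite scaler_nat mulr2n opprD addrA subrr add0r.
have DG w : exists m : R, 'D_w G 0 = w + m *: delta_mx 0 0.
  by eexists; rewrite DGE DtPhi scalerA -scaleNr.
have image_q : \forall q \near (0 : 'rV[R]_2), exists2 q', N q' &
    T2 (f (psi q)) = f (psi q').
  have nPN : nbhs p (psi @` N) by apply: open_nbhs_nbhs; split=> //; exists 0.
  have [V [nV VN TV]] := inv _ nPN NU.
  have nVpsi : nbhs (0 : 'rV[R]_2) (psi @^-1` V).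
    by apply: (smooth_continuous Cpsi N0); rewrite psi0.
  apply: filterS nVpsi => q Vq.
  have [_ [q' Nq' <-] E] : (f @` (psi @` N)) (T2 (f (psi q))).
    by apply: TV; exists (f (psi q)) => //; exists (psi q).
  by exists q'.
have nN : nbhs (0 : 'rV[R]_2) N by exact: open_nbhs_nbhs.
have PsiX q : N q -> Psi (X q) = f (psi q).
  by move=> Nq; rewrite -fX //; have [] := PhiM _ (fM q Nq).
have OX q : N q -> (exists2 q', N q' & T2 (f (psi q)) = f (psi q')) -> O (X q).
  move=> Nq [q' Nq' E]; split; first by rewrite -fX //; have [] := PhiM _ (fM q Nq).
  by rewrite /= PsiX // E; exact: fM.
have imageG : \forall q \near (0 : 'rV[R]_2), umbrella (G (X q)) = 0.
  apply: filterS2 nN image_q => q Nq [q' Nq' E].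
  by rewrite /G /= PsiX // E fX // umbrella_standard.
have [A [eta [[oA A0 Ceta eta0] [deta etaK Xeta]]]] :=
  lift_involution oO O0 CG G0 GO GK DG0 DG imageG.
apply: (symmetry_of_chart lc oA A0 Ceta eta0 deta etaK).
have nNeta : nbhs (0 : 'rV[R]_2) (eta @^-1` N).
  by apply: (smooth_continuous Ceta A0); rewrite eta0.
near=> q.
have Nq : N q by near: q.
have Neq : N (eta q) by near: q; exact: nNeta.
have imq : exists2 q', N q' & T2 (f (psi q)) = f (psi q') by near: q.
have Xq : X (eta q) = G (X q) by near: q.
have := congr1 Psi Xq; rewrite PsiG; last exact: OX.
by rewrite !PsiX.
Unshelve. all: by end_near. Qed.

End image.

(** * Equivalence of the three assertions *)

Theorem mainTheorem4 (R : realType) (U : set 'rV[R]_2)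
    (f : 'rV[R]_2 -> 'rV[R]_3) (p : 'rV[R]_2) (t : 'rV[R]_3)
    (U_open : open U) (f_smooth : smooth U f)
    (Up : U p) (f_cross_cap : cross_cap U f p)
    (t_tangent : tangent_vector U f p t) :
  let T2 := reflection (f p) t in
  (image_germ_invariant U f p T2 <-> has_symmetry U f p T2) /\
  (forall (a : 'rV[R]_2 -> R) (b : R -> R),
    characteristic_functions U f p a b ->
    (has_symmetry U f p T2 <-> symmetric_characteristic_functions a b)).
Proof.
move=> T2; split; first split.
- exact: image_has_symmetry.
- exact: has_symmetry_image.
move=> a b ab; split.
- exact: has_symmetry_symmetric ab.
- exact: symmetric_has_symmetry ab.
Qed.
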